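(* Let $\mu,\nu$ be Borel probability measures on $[0,1)$, both dyadically doubling (there is $C_0\ge1$ with $\mu(\hat I)\le C_0\mu(I)$ and $\nu(\hat I)\le C_0\nu(I)$ for all $I\in\mathcal{D}\setminus\{[0,1)\}$), and assume that for some $C\geq 1$, $$\sum_{I\in\mathcal{D},\, I\subset J} \alpha^2_{\mu,\nu}(I)\mu(I) \leq C\mu(J) \qquad \text{for all } J\in\mathcal{D}.$$ Then $\mu \in A^{\mathcal{D}}_\infty(\nu)$.
   Context: $\mathcal{D}$ denotes the family of dyadic intervals $[j2^{-k},(j+1)2^{-k})\subset[0,1)$, $k\ge0$; $\hat I$ is the parent of $I$. Wasserstein distance: $\mathbb{W}_1(\nu_1,\nu_2) := \sup_\psi |\int\psi\,d\nu_1 - \int\psi\,d\nu_2|$ over all $1$-Lipschitz $\psi\colon\mathbb{R}\to\mathbb{R}$ supported on $[0,1]$. For an interval $I$, $T_I$ is the increasing affine map taking $\overline I$ onto $[0,1]$, $\mu_I := T_{I\sharp}(\mu|_I)/\mu(I)$, $\nu_I := T_{I\sharp}(\nu|_I)/\nu(I)$ (zero if the normalising mass vanishes), and $\alpha_{\mu,\nu}(I) := \mathbb{W}_1(\mu_I,\nu_I)$. The dyadic class $A_\infty^{\mathcal{D}}(\nu)$: $\mu\in A^{\mathcal{D}}_\infty(\nu)$ if there exist constants $C',\delta>0$ such that $\mu(E)/\mu(I)\le C'(\nu(E)/\nu(I))^\delta$ for all $I\in\mathcal{D}$ and all Borel $E\subset I$. *)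

(* Defs.v *)
From Stdlib Require Import Reals Lra Rtopology ClassicalEpsilon.
Open Scope R_scope.

Definition set := R -> Prop.

Inductive borel : set -> Prop :=
| borel_open (U : set) : open_set U -> borel U
| borel_compl (A : set) : borel A -> borel (fun x => ~ A x)
| borel_union (A : nat -> set) :
    (forall n, borel (A n)) -> borel (fun x => exists n, A n x).

Fixpoint sumR (n : nat) (f : nat -> R) : R :=
  match n with O => 0 | S k => sumR k f + f k end.

Definition is_measure (mu : set -> R) : Prop :=
  mu (fun _ => False) = 0 /\
  (forall A, borel A -> 0 <= mu A) /\
  (forall A : nat -> set,
      (forall n, borel (A n)) ->
      (forall n m x, n <> m -> A n x -> A m x -> False) ->
      infinite_sum (fun n => mu (A n)) (mu (fun x => exists n, A n x))).

Definition is_prob_on_01 (mu : set -> R) : Prop :=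
  is_measure mu /\ mu (fun _ => True) = 1 /\
  mu (fun x => ~ (0 <= x < 1)) = 0.

(* Supremum of a set of reals (meaningful when the least upper bound exists). *)
Definition Rsup (E : R -> Prop) : R := epsilon (inhabits 0) (fun l => is_lub E l).

Definition simple_sums (mu : set -> R) (f : R -> R) : R -> Prop :=
  fun r => exists (n : nat) (a : nat -> R) (A : nat -> set),
    (forall i, (i < n)%nat -> 0 <= a i /\ borel (A i)) /\
    (forall i j x, (i < n)%nat -> (j < n)%nat -> i <> j -> A i x -> A j x -> False) /\
    (forall i x, (i < n)%nat -> A i x -> a i <= f x) /\
    r = sumR n (fun i => a i * mu (A i)).

Definition lintegral (mu : set -> R) (f : R -> R) : R := Rsup (simple_sums mu f).

Definition integral (mu : set -> R) (f : R -> R) : R :=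
  lintegral mu (fun x => Rmax (f x) 0) - lintegral mu (fun x => Rmax (- f x) 0).

Definition lip1_supp01 (psi : R -> R) : Prop :=
  (forall x y, Rabs (psi x - psi y) <= Rabs (x - y)) /\
  (forall x, (x < 0 \/ 1 < x) -> psi x = 0).

Definition W1 (nu1 nu2 : set -> R) : R :=
  Rsup (fun r => exists psi, lip1_supp01 psi /\
                   r = Rabs (integral nu1 psi - integral nu2 psi)).

(* Dyadic interval [j 2^-k, (j+1) 2^-k)  (used with j < 2^k). *)
Definition dyadic (k j : nat) : set :=
  fun x => INR j / 2 ^ k <= x < (INR j + 1) / 2 ^ k.

(* Increasing affine map taking the closure of dyadic k j onto [0,1]. *)
Definition T_dyadic (k j : nat) (x : R) : R := x * 2 ^ k - INR j.

Definition blowup (mu : set -> R) (k j : nat) : set -> R :=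
  fun A => if Req_EM_T (mu (dyadic k j)) 0 then 0
           else mu (fun x => dyadic k j x /\ A (T_dyadic k j x)) / mu (dyadic k j).

Definition alpha (mu nu : set -> R) (k j : nat) : R :=
  W1 (blowup mu k j) (blowup nu k j).

Definition dyadic_doubling (C0 : R) (mu : set -> R) : Prop :=
  forall k j, (j < 2 ^ (S k))%nat ->
    mu (dyadic k (Nat.div2 j)) <= C0 * mu (dyadic (S k) j).

Definition rpow (x d : R) : R := if Rle_dec x 0 then 0 else Rpower x d.

Definition A_inf_dyadic (nu mu : set -> R) : Prop :=
  exists C' delta, 0 < C' /\ 0 < delta /\
    forall k j (E : set), (j < 2 ^ k)%nat -> borel E ->
      (forall x, E x -> dyadic k j x) ->
      mu E / mu (dyadic k j) <= C' * rpow (nu E / nu (dyadic k j)) delta.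

Definition included_set (A B : set) : Prop := forall x, A x -> B x.

Definition carleson_partial (mu nu : set -> R) (k j N : nat) : R :=
  sumR (S N) (fun k' =>
    sumR (2 ^ k') (fun j' =>
      if excluded_middle_informative (included_set (dyadic k' j') (dyadic k j))
      then alpha mu nu k' j' ^ 2 * mu (dyadic k' j')
      else 0)).

(* Main.v *)
Require Import Defs.
From Stdlib Require Import Reals Lra Lia Psatz Classical ClassicalEpsilon.
From Stdlib Require Import FunctionalExtensionality PropExtensionality.
Open Scope R_scope.

(** Testing [alpha I] with a tent on the left half of [I], whose integral is bounded below by
    doubling, shows that the difference [Delta I] of the splitting ratios [mu(I-)/mu(I)] and
    [nu(I-)/nu(I)] is at most a constant times [alpha I + alpha I-]; hence [Delta^2] satisfies the
    Carleson condition too. With [M I] the normalised Carleson sum of [Delta^2] below [I], the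
    quantity [mu(I) (mu(I)/nu(I))^eps phi(M I)], [phi] a suitable concave quadratic, is
    at least the sum of its values on the two halves of [I], if [eps] is small. This bounds the
    [(mu/nu)^eps]-moments on the subintervals of [J], so that
    [mu(E)/mu(J) <= nu(E)/(nu(J) y) + C y^eps] for every [y > 0], first for unions of dyadic
    intervals of one generation, then for Borel [E] by approximation in [mu + nu];
    [y = (nu(E)/nu(J))^(1/2)] gives the claim. *)

(** * Borel sets and measures *)

(** The indicator of the left half [I-] is not Lipschitz, so [alpha] does not see the ratio
    [mu(I-)/mu(I)] directly. The integral of a tent on [I-] is that ratio times a factor depending
    on how the measure is distributed inside [I-]; the factors of [mu] and [nu] differ by at most
    [alpha] of [I-], which is why that interval enters the bound.

    When [I] is split, the factor [(mu/nu)^eps] alone produces an excess of order [eps Delta^2],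
    since the terms of order [Delta] cancel in the mean. The growth of [phi] pays for it: the
    Carleson sum of [I] exceeds the mean of those of its halves by exactly [Delta^2]. If the halves
    have different sums X and Y, there is also a mixed error of order [eps |Delta| |X - Y|], which
    growth cannot absorb when [Delta] is small; the strict concavity of [phi] can. All constants are
    independent of the number of generations, so the induction runs over finite trees and limits
    enter only in the approximation of Borel sets. *)

Lemma set_ext (A B : set) : (forall x, A x <-> B x) -> A = B.
Proof.
intros H. apply functional_extensionality. intros x.
apply propositional_extensionality. apply H.
Qed.

Lemma borel_empty : borel (fun _ => False).
Proof. apply borel_open. intros x []. Qed.

Lemma borel_full : borel (fun _ => True).
Proof. apply borel_open. intros x _. exists (mkposreal 1 Rlt_0_1). intros y _. exact I. Qed.

Lemma borel_or (A B : set) : borel A -> borel B -> borel (fun x => A x \/ B x).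
Proof.
intros HA HB.
assert (E : (fun x => A x \/ B x)
            = (fun x => exists n : nat, (match n with O => A | S _ => B end) x)).
{ apply set_ext. intros x; split.
  - intros [H|H]; [exists O | exists 1%nat]; exact H.
  - intros [[|n] H]; [left | right]; exact H. }
rewrite E. apply borel_union. intros [|n]; assumption.
Qed.

Lemma borel_and (A B : set) : borel A -> borel B -> borel (fun x => A x /\ B x).
Proof.
intros HA HB.
assert (E : (fun x => A x /\ B x) = (fun x => ~ (~ A x \/ ~ B x))).
{ apply set_ext. intros x; tauto. }
rewrite E. apply borel_compl, borel_or; now apply borel_compl.
Qed.

Lemma borel_diff (A B : set) : borel A -> borel B -> borel (fun x => A x /\ ~ B x).
Proof. intros HA HB. apply borel_and; [exact HA | now apply borel_compl]. Qed.

Lemma borel_preimage_affine (a b : R) (A : set) :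
  0 < a -> borel A -> borel (fun x => A (a * x + b)).
Proof.
intros Ha HA. induction HA as [U HU | A _ IH | A _ IH].
- apply borel_open. intros x Hx. destruct (HU _ Hx) as [d Hd].
  assert (Hd' : 0 < d / a) by (apply Rdiv_lt_0_compat; [apply cond_pos | exact Ha]).
  exists (mkposreal _ Hd'). intros y Hy. apply Hd. unfold disc in *. cbn in Hy.
  replace (a * y + b - (a * x + b)) with (a * (y - x)) by ring.
  rewrite Rabs_mult, (Rabs_right a) by lra.
  apply Rmult_lt_reg_l with (/ a); [now apply Rinv_0_lt_compat|].
  rewrite <- Rmult_assoc, Rinv_l, Rmult_1_l by lra.
  unfold Rdiv in Hy. lra.
- exact (borel_compl _ IH).
- exact (borel_union _ IH).
Qed.

Lemma borel_lt (a : R) : borel (fun x => x < a).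
Proof.
apply borel_open. intros x Hx. assert (H : 0 < a - x) by lra.
exists (mkposreal _ H). intros y Hy. unfold disc in Hy. cbn in Hy.
apply Rabs_def2 in Hy. lra.
Qed.

Lemma borel_dyadic (k j : nat) : borel (dyadic k j).
Proof.
unfold dyadic.
assert (E : (fun x => INR j / 2 ^ k <= x < (INR j + 1) / 2 ^ k)
            = (fun x => ~ (x < INR j / 2 ^ k) /\ x < (INR j + 1) / 2 ^ k)).
{ apply set_ext. intros x; split; intros [H1 H2]; split; lra. }
rewrite E. apply borel_and; [apply borel_compl|]; apply borel_lt.
Qed.

Lemma measure_or (mu : set -> R) (A B : set) :
  is_measure mu -> borel A -> borel B -> (forall x, A x -> B x -> False) ->
  mu (fun x => A x \/ B x) = mu A + mu B.
Proof.
intros [H0 [_ Hadd]] HA HB HAB.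
set (F := fun n : nat => match n with O => A | 1%nat => B | _ => fun _ : R => False end).
assert (E : (fun x => A x \/ B x) = (fun x => exists n, F n x)).
{ apply set_ext. intros x; split.
  - intros [H|H]; [exists O | exists 1%nat]; exact H.
  - intros [[|[|n]] H]; cbn in H; tauto. }
rewrite E. apply uniqueness_sum with (fun n => mu (F n)).
- apply Hadd.
  + intros [|[|n]]; cbn; auto using borel_empty.
  + intros [|[|n]] [|[|m]] x Hnm; cbn; try tauto; try lia; eauto.
- assert (S : forall n, sum_f_R0 (fun n => mu (F n)) (S n) = mu A + mu B).
  { induction n as [|n IH]; [reflexivity|].
    rewrite tech5, IH. cbn. rewrite H0. ring. }
  intros eps Heps. exists 1%nat. intros [|n] Hn; [lia|].
  rewrite S. unfold Rdist. rewrite Rminus_diag, Rabs_R0. exact Heps.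
Qed.

Lemma measure_ge0 (mu : set -> R) (A : set) : is_measure mu -> borel A -> 0 <= mu A.
Proof. intros [_ [H _]]; apply H. Qed.

Lemma measure_split (mu : set -> R) (A B : set) :
  is_measure mu -> borel A -> borel B ->
  mu A = mu (fun x => A x /\ B x) + mu (fun x => A x /\ ~ B x).
Proof.
intros Hmu HA HB.
rewrite <- measure_or by (auto using borel_and, borel_diff; intros; tauto).
f_equal. apply set_ext. intros x. tauto.
Qed.

Lemma measure_mono (mu : set -> R) (A B : set) :
  is_measure mu -> borel A -> borel B -> (forall x, A x -> B x) -> mu A <= mu B.
Proof.
intros Hmu HA HB HAB. rewrite (measure_split mu B A) by assumption.
assert (E : (fun x => B x /\ A x) = A) by (apply set_ext; intros x; split; firstorder).
rewrite E. pose proof (measure_ge0 mu _ Hmu (borel_diff _ _ HB HA)). lra.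
Qed.

Lemma measure_subadd (mu : set -> R) (A B D : set) :
  is_measure mu -> borel A -> borel B -> borel D ->
  (forall x, A x -> B x \/ D x) -> mu A <= mu B + mu D.
Proof.
intros Hmu HA HB HD HABD. rewrite (measure_split mu A B) by assumption.
apply Rplus_le_compat.
- apply measure_mono; auto using borel_and; tauto.
- apply measure_mono; auto using borel_diff. intros x [H1 H2]. destruct (HABD x H1); tauto.
Qed.

Lemma measure_continuity (mu : set -> R) (B : nat -> set) :
  is_measure mu -> (forall n, borel (B n)) -> (forall n x, B n x -> B (S n) x) ->
  Un_cv (fun n => mu (B n)) (mu (fun x => exists n, B n x)).
Proof.
intros Hmu HB Hinc.
assert (Hinc' : forall n m, (n <= m)%nat -> forall x, B n x -> B m x).
{ intros n m Hnm. induction Hnm; auto. }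
set (D := fun n : nat => match n with
                         | O => B O | S m => fun x => B (S m) x /\ ~ B m x end).
assert (HD : forall n, borel (D n)) by (intros [|n]; cbn; auto using borel_diff).
assert (HDB : forall n x, D n x -> B n x) by (intros [|n] x; cbn; tauto).
assert (HDlt : forall n m x, (n < m)%nat -> D n x -> D m x -> False).
{ intros n [|m] x Hnm H1 H2; [lia|]. destruct H2 as [_ H2]. apply H2.
  apply (Hinc' n); [lia | now apply HDB]. }
assert (E : (fun x => exists n, B n x) = (fun x => exists n, D n x)).
{ apply set_ext. intros x; split; intros [n Hn]; [|exists n; now apply HDB].
  induction n as [|n IH]; [now exists O|].
  destruct (classic (B n x)) as [H|H]; [auto | exists (S n); split; assumption]. }
rewrite E.
assert (Hsum : infinite_sum (fun n => mu (D n)) (mu (fun x => exists n, D n x))).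
{ apply Hmu; [exact HD|]. intros n m x Hnm H1 H2.
  destruct (Nat.lt_total n m) as [H|[H|H]]; eauto. }
assert (S : forall n, sum_f_R0 (fun n => mu (D n)) n = mu (B n)).
{ induction n as [|n IH]; [reflexivity|].
  rewrite tech5, IH, (measure_split mu (B (S n)) (B n)) by auto.
  f_equal. f_equal. apply set_ext. intros x; split; [|tauto]. intros H; split; auto. }
intros eps Heps. destruct (Hsum eps Heps) as [N HN]. exists N. intros n Hn.
rewrite <- S. now apply HN.
Qed.

Lemma measure_plus (mu nu : set -> R) :
  is_measure mu -> is_measure nu -> is_measure (fun A => mu A + nu A).
Proof.
intros [H0 [H1 H2]] [K0 [K1 K2]]. split; [rewrite H0, K0; ring|]. split.
- intros A HA. specialize (H1 A HA). specialize (K1 A HA). lra.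
- intros A HA HD eps Heps.
  destruct (CV_plus _ _ _ _ (H2 A HA HD) (K2 A HA HD) eps Heps) as [N HN].
  exists N. intros n Hn. rewrite plus_sum. now apply HN.
Qed.

(** [J] is quantified inside the induction because each step removes the last set from it. *)
Lemma sum_disjoint_le (mu : set -> R) (n : nat) :
  is_measure mu -> forall (B : nat -> set) (J : set), borel J ->
  (forall i, (i < n)%nat -> borel (B i)) ->
  (forall i j x, (i < n)%nat -> (j < n)%nat -> i <> j -> B i x -> B j x -> False) ->
  (forall i x, (i < n)%nat -> B i x -> J x) ->
  sumR n (fun i => mu (B i)) <= mu J.
Proof.
intros Hmu. induction n as [|n IH]; intros B J HJ HB Hdisj Hsub; cbn.
- now apply measure_ge0.
- rewrite (measure_split mu J (B n)) by auto.
  assert (E : (fun x => J x /\ B n x) = B n).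
  { apply set_ext. intros x; split; [tauto|]. intros H; split; eauto. }
  rewrite E. rewrite Rplus_comm. apply Rplus_le_compat_l. apply IH.
  + apply borel_diff; auto.
  + intros i Hi; apply HB; lia.
  + intros i j x Hi Hj; apply Hdisj; lia.
  + intros i x Hi Hx; split; [apply (Hsub i); auto|].
    intros Hn. apply (Hdisj i n x); auto; lia.
Qed.

(** * Dyadic intervals *)

(** In the affine coordinate [T_dyadic] the interval is [0, 1) and its halves are cut at 1/2, so
    that facts about dyadic intervals become linear arithmetic. *)
Lemma dyadic_iff (k j : nat) (x : R) :
  dyadic k j x <-> 0 <= T_dyadic k j x < 1.
Proof.
unfold dyadic, T_dyadic. assert (H : 0 < 2 ^ k) by (apply pow_lt; lra).
assert (E1 : INR j / 2 ^ k * 2 ^ k = INR j) by (field; lra).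
assert (E2 : (INR j + 1) / 2 ^ k * 2 ^ k = INR j + 1) by (field; lra).
split; intros [H1 H2]; split.
- apply Rmult_le_compat_r with (r := 2 ^ k) in H1; lra.
- apply Rmult_lt_compat_r with (r := 2 ^ k) in H2; lra.
- apply Rmult_le_reg_r with (2 ^ k); lra.
- apply Rmult_lt_reg_r with (2 ^ k); lra.
Qed.

Lemma T_dyadic_left (k j : nat) (x : R) :
  T_dyadic (S k) (2 * j) x = 2 * T_dyadic k j x.
Proof. unfold T_dyadic. rewrite mult_INR. simpl. ring. Qed.

Lemma T_dyadic_right (k j : nat) (x : R) :
  T_dyadic (S k) (2 * j + 1) x = 2 * T_dyadic k j x - 1.
Proof. unfold T_dyadic. rewrite plus_INR, mult_INR. simpl. ring. Qed.

Lemma dyadic_left_iff (k j : nat) (x : R) :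
  dyadic (S k) (2 * j) x <-> 0 <= T_dyadic k j x < 1 / 2.
Proof. rewrite dyadic_iff, T_dyadic_left. split; lra. Qed.

Lemma dyadic_right_iff (k j : nat) (x : R) :
  dyadic (S k) (2 * j + 1) x <-> 1 / 2 <= T_dyadic k j x < 1.
Proof. rewrite dyadic_iff, T_dyadic_right. split; lra. Qed.

Lemma dyadic_split (k j : nat) (x : R) :
  dyadic k j x <-> dyadic (S k) (2 * j) x \/ dyadic (S k) (2 * j + 1) x.
Proof. rewrite dyadic_left_iff, dyadic_right_iff, dyadic_iff. lra. Qed.

Lemma dyadic_inj (k i j : nat) (x : R) : dyadic k i x -> dyadic k j x -> i = j.
Proof.
rewrite !dyadic_iff. unfold T_dyadic. intros H1 H2.
assert (INR i < INR (S j)) by (rewrite S_INR; lra).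
assert (INR j < INR (S i)) by (rewrite S_INR; lra).
apply INR_lt in H. apply INR_lt in H0. lia.
Qed.

Lemma dyadic_00_iff (x : R) : dyadic 0 0 x <-> 0 <= x < 1.
Proof. rewrite dyadic_iff. unfold T_dyadic. simpl. split; lra. Qed.

Lemma dyadic_cover (k : nat) (x : R) : 0 <= x < 1 -> exists j, dyadic k j x.
Proof.
intros Hx. induction k as [|k [j Hj]].
- exists O. now apply dyadic_00_iff.
- apply dyadic_split in Hj. destruct Hj; eauto.
Qed.

Lemma dyadic_parent (k j : nat) (x : R) : dyadic (S k) j x -> dyadic k (Nat.div2 j) x.
Proof.
intros H. destruct (Nat.Even_or_Odd j) as [[i ->]|[i ->]].
- rewrite Nat.div2_double. apply dyadic_split. now left.
- replace (Nat.div2 (2 * i + 1)) with i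
    by (rewrite Nat.add_1_r; now rewrite Nat.div2_succ_double).
  apply dyadic_split. now right.
Qed.

Lemma INR_lt_pow2 (k : nat) : INR k < 2 ^ k.
Proof.
induction k as [|k IH]; [simpl; lra|]. rewrite S_INR. simpl.
assert (1 <= 2 ^ k) by (apply pow_R1_Rle; lra). lra.
Qed.

(* [F] is a union of dyadic intervals of generation [k], up to what it contains of
   the negative half-line. *)
Definition level_set (k : nat) (F : set) : Prop :=
  forall j x y, dyadic k j x -> dyadic k j y -> F x -> F y.

Lemma level_set_mono (k l : nat) (F : set) :
  (k <= l)%nat -> level_set k F -> level_set l F.
Proof.
intros Hkl HF. induction Hkl as [|l _ IH]; [exact HF|].
intros j x y Hx Hy. apply (IH (Nat.div2 j)); now apply dyadic_parent.
Qed.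

Lemma level_set_or (k : nat) (F G : set) :
  level_set k F -> level_set k G -> level_set k (fun x => F x \/ G x).
Proof. intros HF HG j x y Hx Hy [H|H]; [left | right]; eauto. Qed.

Lemma level_set_compl (k : nat) (F : set) :
  level_set k F -> level_set k (fun x => ~ F x).
Proof. intros HF j x y Hx Hy H H'. apply H. eauto. Qed.

(** * Approximation of Borel sets by level sets *)

Definition symdiff (A B : set) : set := fun x => (A x /\ ~ B x) \/ (B x /\ ~ A x).

Lemma borel_symdiff (A B : set) : borel A -> borel B -> borel (symdiff A B).
Proof. intros; apply borel_or; now apply borel_diff. Qed.

Definition dyadic_approximable (rho : set -> R) (A : set) : Prop :=
  forall eta, 0 < eta ->
  exists k F, borel F /\ level_set k F /\ rho (symdiff A F) < eta.

(** The unions of the generation [k] intervals contained in [U] increase to the part of [U] in [0,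
    1), and the rest of [U] is null. *)
Lemma dyadic_approximable_open (rho : set -> R) (U : set) :
  is_measure rho -> rho (fun x => ~ (0 <= x < 1)) = 0 -> open_set U ->
  dyadic_approximable rho U.
Proof.
intros Hrho Hout HU eta Heta.
set (V := fun k x => exists j, dyadic k j x /\ (forall y, dyadic k j y -> U y)).
assert (HV : forall k, borel (V k)).
{ intros k. apply borel_union. intros j.
  (* The second condition does not involve [x], so the set is the whole interval or empty. *)
  destruct (classic (forall y, dyadic k j y -> U y)) as [H|H].
  - replace (fun x => dyadic k j x /\ (forall y, dyadic k j y -> U y)) with (dyadic k j).
    apply borel_dyadic. apply set_ext; tauto.
  - replace (fun x => dyadic k j x /\ (forall y, dyadic k j y -> U y))
      with (fun _ : R => False). apply borel_empty. apply set_ext; tauto. }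
assert (Hinc : forall k x, V k x -> V (S k) x).
{ intros k x [j [Hx Hj]]. apply dyadic_split in Hx.
  destruct Hx as [Hx|Hx]; [exists (2 * j)%nat | exists (2 * j + 1)%nat];
    (split; [exact Hx|]); intros y Hy; apply Hj, dyadic_split; tauto. }
assert (HVU : forall k x, V k x -> U x) by (intros k x [j [Hx Hj]]; auto).
assert (HUV : forall x, 0 <= x < 1 -> U x -> exists k, V k x).
{ intros x Hx HUx. destruct (HU x HUx) as [d Hd].
  (* [k > 1/d] gives [2^-k < d], so the generation [k] interval around [x] stays within distance [d]
     of [x]. *)
  destruct (INR_unbounded (/ d)) as [k Hk]. exists k.
  destruct (dyadic_cover k x Hx) as [j Hj]. exists j. split; [exact Hj|].
  intros y Hy. apply Hd. unfold disc.
  apply dyadic_iff in Hj. apply dyadic_iff in Hy. unfold T_dyadic in *.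
  pose proof (INR_lt_pow2 k) as Hk'. pose proof (cond_pos d) as Hd0.
  assert (H1 : 1 < d * 2 ^ k).
  { apply Rmult_lt_reg_l with (/ d); [now apply Rinv_0_lt_compat|].
    rewrite <- Rmult_assoc, Rinv_l by lra. lra. }
  assert (H2 : 0 < 2 ^ k) by (apply pow_lt; lra).
  apply Rabs_def1; apply Rmult_lt_reg_r with (2 ^ k); lra. }
assert (HbU := borel_open U HU).
assert (Hlim : rho U <= rho (fun x => exists k, V k x)).
{ assert (HbO : borel (fun x => ~ (0 <= x < 1))).
  { apply borel_compl. replace (fun x => 0 <= x < 1) with (dyadic 0 0).
    apply borel_dyadic. apply set_ext. apply dyadic_00_iff. }
  rewrite <- (Rplus_0_r (rho (fun x => exists k, V k x))), <- Hout.
  apply measure_subadd; auto using borel_union.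
  intros x Hx. destruct (classic (0 <= x < 1)); [left | right]; auto. }
destruct (measure_continuity rho V Hrho HV Hinc eta Heta) as [k Hk].
specialize (Hk k (Nat.le_refl k)). unfold Rdist in Hk. apply Rabs_def2 in Hk.
exists k, (V k). split; [apply HV|]. split.
- intros j x y Hx Hy [i [Hi Hi']]. rewrite (dyadic_inj k i j x Hi Hx) in *.
  exists j. auto.
- replace (symdiff U (V k)) with (fun x => U x /\ ~ V k x).
  2:{ apply set_ext. intros x. unfold symdiff. specialize (HVU k x). tauto. }
  assert (E := measure_split rho U (V k) Hrho HbU (HV k)).
  replace (fun x => U x /\ V k x) with (V k) in E.
  2:{ apply set_ext. intros x. specialize (HVU k x). tauto. }
  lra.
Qed.

Lemma dyadic_approximable_or (rho : set -> R) (A B : set) :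
  is_measure rho -> borel A -> borel B ->
  dyadic_approximable rho A -> dyadic_approximable rho B ->
  dyadic_approximable rho (fun x => A x \/ B x).
Proof.
intros Hrho HbA HbB HA HB eta Heta.
destruct (HA (eta / 2)) as [k [F [HF1 [HF2 HF3]]]]; [lra|].
destruct (HB (eta / 2)) as [l [G [HG1 [HG2 HG3]]]]; [lra|].
exists (Nat.max k l), (fun x => F x \/ G x). split; [now apply borel_or|]. split.
- apply level_set_or; [apply (level_set_mono k) | apply (level_set_mono l)]; auto; lia.
- apply Rle_lt_trans with (rho (symdiff A F) + rho (symdiff B G)); [|lra].
  apply measure_subadd; auto using borel_symdiff, borel_or.
  intros x. unfold symdiff. tauto.
Qed.

(** Taking complements of both sets leaves the symmetric difference unchanged, and by continuity
    from below a countable union is close to a finite one. *)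
Lemma borel_dyadic_approximable (rho : set -> R) (A : set) :
  is_measure rho -> rho (fun x => ~ (0 <= x < 1)) = 0 -> borel A ->
  dyadic_approximable rho A.
Proof.
intros Hrho Hout HA. induction HA as [U HU | A HA IH | A HA IH].
- now apply dyadic_approximable_open.
- intros eta Heta. destruct (IH eta Heta) as [k [F [H1 [H2 H3]]]].
  exists k, (fun x => ~ F x). split; [now apply borel_compl|].
  split; [now apply level_set_compl|].
  replace (symdiff (fun x => ~ A x) (fun x => ~ F x)) with (symdiff A F); [exact H3|].
  apply set_ext. intros x. unfold symdiff. tauto.
- set (B := fix B (n : nat) : set :=
         match n with O => A O | S m => fun x => B m x \/ A (S m) x end).
  assert (HB : forall n, borel (B n) /\ dyadic_approximable rho (B n)).
  { induction n as [|n [IH1 IH2]]; cbn; [auto|].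
    split; [now apply borel_or | now apply dyadic_approximable_or]. }
  assert (HBA : forall n x, B n x -> exists m, A m x).
  { induction n as [|n IHn]; cbn; intros x H; [eauto|]. destruct H; eauto. }
  assert (E : (fun x => exists n, A n x) = (fun x => exists n, B n x)).
  { apply set_ext. intros x; split; intros [n Hn]; [|eauto].
    exists n. destruct n; cbn; auto. }
  assert (HbA : borel (fun x => exists n, A n x)) by now apply borel_union.
  intros eta Heta.
  assert (Hcv := measure_continuity rho B Hrho (fun n => proj1 (HB n))
                   (fun n x H => or_introl H)).
  rewrite <- E in Hcv. destruct (Hcv (eta / 2)) as [n Hn]; [lra|].
  specialize (Hn n (Nat.le_refl n)). unfold Rdist in Hn. apply Rabs_def2 in Hn.
  destruct (HB n) as [HBn HBn'].
  destruct (HBn' (eta / 2)) as [k [F [H1 [H2 H3]]]]; [lra|].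
  exists k, F. split; [exact H1|]. split; [exact H2|].
  assert (Hs := measure_split rho _ (B n) Hrho HbA HBn). cbv beta in Hs.
  replace (fun x => (exists n, A n x) /\ B n x) with (B n) in Hs.
  2:{ apply set_ext. intros x. specialize (HBA n x). tauto. }
  apply Rle_lt_trans
    with (rho (fun x => (exists n, A n x) /\ ~ B n x) + rho (symdiff (B n) F)); [|lra].
  apply measure_subadd; auto using borel_symdiff, borel_diff.
  intros x. unfold symdiff. specialize (HBA n x). tauto.
Qed.

(** * Wasserstein distance controls the splitting ratios *)

Lemma Rabs_le_inv (x a : R) : Rabs x <= a -> - a <= x <= a.
Proof. unfold Rabs. destruct Rcase_abs; lra. Qed.

(** [Rsup] is an arbitrary choice unless a least upper bound exists, so each [lintegral] and [alpha]
    has to be shown bounded before it can be compared with anything. *)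
Lemma Rsup_lub (E : R -> Prop) (M : R) :
  (exists x, E x) -> (forall x, E x -> x <= M) -> is_lub E (Rsup E).
Proof.
intros Hne HM. unfold Rsup. apply epsilon_spec.
destruct (completeness E) as [l Hl]; [exists M; exact HM | exact Hne | now exists l].
Qed.

Lemma borel_blowup_set (k j : nat) (A : set) :
  borel A -> borel (fun x => dyadic k j x /\ A (T_dyadic k j x)).
Proof.
intros HA. apply borel_and; [apply borel_dyadic|].
replace (fun x => A (T_dyadic k j x)) with (fun x => A (2 ^ k * x + - INR j)).
- apply borel_preimage_affine; [apply pow_lt; lra | exact HA].
- apply set_ext. intros x. unfold T_dyadic.
  replace (2 ^ k * x + - INR j) with (x * 2 ^ k - INR j) by ring. tauto.
Qed.

Lemma blowup_eq (mu : set -> R) (k j : nat) (A : set) :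
  0 < mu (dyadic k j) ->
  blowup mu k j A
  = mu (fun x => dyadic k j x /\ A (T_dyadic k j x)) / mu (dyadic k j).
Proof. intros H. unfold blowup. destruct Req_EM_T; [lra | reflexivity]. Qed.

Lemma blowup_empty (mu : set -> R) (k j : nat) (A : set) :
  is_measure mu -> (forall x, dyadic k j x -> ~ A (T_dyadic k j x)) ->
  blowup mu k j A = 0.
Proof.
intros Hmu HA. unfold blowup. destruct Req_EM_T; [reflexivity|].
replace (fun x => dyadic k j x /\ A (T_dyadic k j x)) with (fun _ : R => False).
- destruct Hmu as [-> _]. unfold Rdiv. ring.
- apply set_ext. intros x. specialize (HA x). tauto.
Qed.

Lemma sumR_le (n : nat) (f g : nat -> R) :
  (forall i, (i < n)%nat -> f i <= g i) -> sumR n f <= sumR n g.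
Proof.
induction n as [|n IH]; intros H; cbn; [lra|].
apply Rplus_le_compat; [apply IH; intros; apply H|apply H]; lia.
Qed.

Lemma sumR_scal (n : nat) (c : R) (f : nat -> R) :
  sumR n (fun i => c * f i) = c * sumR n f.
Proof. induction n as [|n IH]; cbn; [|rewrite IH]; ring. Qed.

Lemma sumR_eq (n : nat) (f g : nat -> R) :
  (forall i, (i < n)%nat -> f i = g i) -> sumR n f = sumR n g.
Proof.
intros H. apply Rle_antisym; apply sumR_le; intros i Hi; rewrite H by exact Hi; lra.
Qed.

(** The sets of a simple sum pull back to disjoint Borel subsets of the dyadic interval, so their
    masses add up to at most that of the interval. *)
Lemma simple_sums_blowup_le (mu : set -> R) (k j : nat) (f : R -> R) (M r : R) :
  is_measure mu -> 0 < mu (dyadic k j) -> 0 <= M -> (forall x, f x <= M) ->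
  simple_sums (blowup mu k j) f r -> r <= M.
Proof.
intros Hmu Hpos HM Hf [n [a [A [HA [Hdisj [Haf ->]]]]]].
set (B := fun i x => dyadic k j x /\ A i (T_dyadic k j x)).
apply Rle_trans with (sumR n (fun i => M / mu (dyadic k j) * mu (B i))).
- apply sumR_le. intros i Hi. destruct (HA i Hi) as [Hai HbA].
  pose proof (measure_ge0 mu _ Hmu (borel_blowup_set k j _ HbA)) as Hge.
  (* On an empty [A i] the coefficient [a i] is not bounded by [M], but the mass vanishes. *)
  destruct (classic (exists x, A i x)) as [[x Hx]|Hne].
  + rewrite blowup_eq by assumption.
    replace (M / mu (dyadic k j) * mu (B i)) with (M * (mu (B i) / mu (dyadic k j)))
      by (field; lra).
    apply Rmult_le_compat_r.
    * apply Rmult_le_pos; [exact Hge | now apply Rlt_le, Rinv_0_lt_compat].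
    * apply Rle_trans with (f x); eauto.
  + rewrite blowup_empty by (auto; intros x _ Hx; apply Hne; eauto).
    rewrite Rmult_0_r. apply Rmult_le_pos; [|exact Hge].
    apply Rmult_le_pos; [exact HM | now apply Rlt_le, Rinv_0_lt_compat].
- rewrite sumR_scal.
  apply Rle_trans with (M / mu (dyadic k j) * mu (dyadic k j)); [|right; field; lra].
  apply Rmult_le_compat_l.
  + apply Rmult_le_pos; [exact HM | now apply Rlt_le, Rinv_0_lt_compat].
  + apply sum_disjoint_le; auto using borel_dyadic.
    * intros i Hi. apply borel_blowup_set. now apply HA.
    * intros i i' x Hi Hi' Hne [_ H1] [_ H2]. eapply Hdisj; eauto.
    * intros i x Hi [H _]. exact H.
Qed.

Lemma simple_sums_0 (b : set -> R) (f : R -> R) : simple_sums b f 0.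
Proof.
exists O, (fun _ => 0), (fun _ _ => False).
repeat split; intros; try lia; reflexivity.
Qed.

Lemma lintegral_blowup_lub (mu : set -> R) (k j : nat) (f : R -> R) (M : R) :
  is_measure mu -> 0 < mu (dyadic k j) -> 0 <= M -> (forall x, f x <= M) ->
  is_lub (simple_sums (blowup mu k j) f) (lintegral (blowup mu k j) f).
Proof.
intros Hmu Hpos HM Hf. apply Rsup_lub with M.
- exists 0. apply simple_sums_0.
- intros r. now apply simple_sums_blowup_le.
Qed.

Lemma lintegral_blowup_bounds (mu : set -> R) (k j : nat) (f : R -> R) (M : R) :
  is_measure mu -> 0 < mu (dyadic k j) -> 0 <= M -> (forall x, f x <= M) ->
  0 <= lintegral (blowup mu k j) f <= M.
Proof.
intros Hmu Hpos HM Hf.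
destruct (lintegral_blowup_lub mu k j f M Hmu Hpos HM Hf) as [Hub Hlub]. split.
- apply Hub, simple_sums_0.
- apply Hlub. intros r. now apply simple_sums_blowup_le.
Qed.

Lemma integral_nonneg_eq (mu : set -> R) (k j : nat) (f : R -> R) :
  is_measure mu -> 0 < mu (dyadic k j) -> (forall x, 0 <= f x) ->
  integral (blowup mu k j) f = lintegral (blowup mu k j) f.
Proof.
intros Hmu Hpos Hf. unfold integral.
assert (E : (fun x => Rmax (f x) 0) = f).
{ apply functional_extensionality. intros x. now apply Rmax_left. }
rewrite E.
destruct (lintegral_blowup_bounds mu k j (fun x => Rmax (- f x) 0) 0 Hmu Hpos)
  as [H1 H2]; [lra | | lra].
intros x. apply Rmax_lub; [specialize (Hf x)|]; lra.
Qed.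

Lemma lip1_supp01_bound (psi : R -> R) (x : R) : lip1_supp01 psi -> Rabs (psi x) <= 2.
Proof.
intros [Hlip Hsupp].
destruct (Rlt_le_dec x 0) as [H|H]; [rewrite Hsupp, Rabs_R0; lra|].
destruct (Rlt_le_dec 1 x) as [H'|H']; [rewrite Hsupp, Rabs_R0; lra|].
(* The support condition gives zeros only strictly outside [0, 1]; the zero at -1 is at distance at
   most 2 from [x]. *)
specialize (Hlip x (-1)). rewrite (Hsupp (-1)), Rminus_0_r in Hlip by lra.
rewrite (Rabs_right (x - -1)) in Hlip; lra.
Qed.

Lemma integral_lip1_bound (mu : set -> R) (k j : nat) (psi : R -> R) :
  is_measure mu -> 0 < mu (dyadic k j) -> lip1_supp01 psi ->
  Rabs (integral (blowup mu k j) psi) <= 2.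
Proof.
intros Hmu Hpos Hpsi. unfold integral.
assert (Hb : forall x, -2 <= psi x <= 2).
{ intros x. apply Rabs_le_inv. now apply lip1_supp01_bound. }
destruct (lintegral_blowup_bounds mu k j (fun x => Rmax (psi x) 0) 2 Hmu Hpos);
  [lra | intros x; specialize (Hb x); apply Rmax_lub; lra |].
destruct (lintegral_blowup_bounds mu k j (fun x => Rmax (- psi x) 0) 2 Hmu Hpos);
  [lra | intros x; specialize (Hb x); apply Rmax_lub; lra |].
apply Rabs_le. lra.
Qed.

Lemma lip1_supp01_zero : lip1_supp01 (fun _ => 0).
Proof.
split; [|reflexivity]. intros x y. rewrite Rminus_diag, Rabs_R0. apply Rabs_pos.
Qed.

Lemma alpha_lub (mu nu : set -> R) (k j : nat) :
  is_measure mu -> is_measure nu -> 0 < mu (dyadic k j) -> 0 < nu (dyadic k j) ->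
  is_lub (fun r => exists psi, lip1_supp01 psi /\
            r = Rabs (integral (blowup mu k j) psi - integral (blowup nu k j) psi))
         (alpha mu nu k j).
Proof.
intros Hmu Hnu Hmp Hnp. apply Rsup_lub with 4.
- eexists. exists (fun _ => 0). split; [apply lip1_supp01_zero | reflexivity].
- intros r [psi [Hpsi ->]].
  pose proof (Rabs_le_inv _ _ (integral_lip1_bound mu k j psi Hmu Hmp Hpsi)).
  pose proof (Rabs_le_inv _ _ (integral_lip1_bound nu k j psi Hnu Hnp Hpsi)).
  apply Rabs_le. lra.
Qed.

Definition tent (x : R) : R := Rmax 0 (Rmin x (1 - x)).
(** Half of [tent (2 x)]: the factor 1/2 keeps the slope at 1, so that this function too is
    admissible in [W1]. *)
Definition left_tent (x : R) : R := Rmax 0 (Rmin x (1 / 2 - x)).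

Lemma lip1_supp01_tent : lip1_supp01 tent.
Proof.
split; unfold tent, Rmax, Rmin, Rabs; intros;
  repeat (destruct Rle_dec || destruct Rcase_abs); lra.
Qed.

Lemma lip1_supp01_left_tent : lip1_supp01 left_tent.
Proof.
split; unfold left_tent, Rmax, Rmin, Rabs; intros;
  repeat (destruct Rle_dec || destruct Rcase_abs); lra.
Qed.

Lemma tent_bounds (x : R) : 0 <= tent x <= 1.
Proof. unfold tent, Rmax, Rmin; repeat destruct Rle_dec; lra. Qed.

Lemma left_tent_bounds (x : R) : 0 <= left_tent x <= 1.
Proof. unfold left_tent, Rmax, Rmin; repeat destruct Rle_dec; lra. Qed.

Lemma left_tent_supp (x : R) : 0 < left_tent x -> 0 <= x < 1 / 2.
Proof. unfold left_tent, Rmax, Rmin; repeat destruct Rle_dec; lra. Qed.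

Lemma tent_double (x : R) : tent (2 * x) = 2 * left_tent x.
Proof. unfold tent, left_tent, Rmax, Rmin; repeat destruct Rle_dec; lra. Qed.

Lemma blowup_left_child (mu : set -> R) (k j : nat) (A : set) :
  is_measure mu -> 0 < mu (dyadic k j) -> 0 < mu (dyadic (S k) (2 * j)) ->
  (forall x, A x -> 0 <= x < 1 / 2) ->
  blowup mu k j A
  = mu (dyadic (S k) (2 * j)) / mu (dyadic k j)
    * blowup mu (S k) (2 * j) (fun y => A (y / 2)).
Proof.
intros Hmu Hpos Hpos' HA. rewrite !blowup_eq by assumption.
replace (fun x => dyadic (S k) (2 * j) x /\ A (T_dyadic (S k) (2 * j) x / 2))
  with (fun x => dyadic k j x /\ A (T_dyadic k j x)); [field; lra|].
apply set_ext. intros x. rewrite T_dyadic_left, dyadic_left_iff, dyadic_iff.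
replace (2 * T_dyadic k j x / 2) with (T_dyadic k j x) by field.
specialize (HA (T_dyadic k j x)). split; intros [H1 H2]; specialize (HA H2); split; auto; lra.
Qed.

(** The dilation [y = 2 x] matches simple sums on the interval with simple sums on its left half; it
    is the change of variables, carried out before suprema are taken. *)
Lemma simple_sums_left_tent (mu : set -> R) (k j : nat) (r : R) :
  is_measure mu -> 0 < mu (dyadic k j) -> 0 < mu (dyadic (S k) (2 * j)) ->
  simple_sums (blowup mu k j) left_tent r <->
  exists s, simple_sums (blowup mu (S k) (2 * j)) tent s /\
            r = mu (dyadic (S k) (2 * j)) / mu (dyadic k j) / 2 * s.
Proof.
intros Hmu Hpos Hpos'.
assert (Hterm : forall a A, (0 <= a /\ borel A) ->
  (forall x, A x -> a <= left_tent x) ->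
  a * blowup mu k j A
  = mu (dyadic (S k) (2 * j)) / mu (dyadic k j) / 2
    * ((2 * a) * blowup mu (S k) (2 * j) (fun y => A (y / 2)))).
(* A set with positive coefficient lies where [left_tent > 0], hence in the left half; one with
   coefficient 0 may lie anywhere but contributes nothing to either side. *)
{ intros a A [Ha HbA] HaA. destruct (Req_dec a 0) as [->|Hne]; [ring|].
  rewrite blowup_left_child; try assumption; [field; lra|].
  intros x Hx. apply left_tent_supp. specialize (HaA x Hx). lra. }
split.
- intros [n [a [A [HA [Hdisj [Haf ->]]]]]].
  exists (sumR n (fun i => (2 * a i) * blowup mu (S k) (2 * j) (fun y => A i (y / 2)))).
  split.
  + exists n, (fun i => 2 * a i), (fun i y => A i (y / 2)).
    split; [|split; [|split; [|reflexivity]]].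
    * intros i Hi. destruct (HA i Hi) as [H1 H2]. split; [lra|].
      replace (fun y => A i (y / 2)) with (fun y => A i (/ 2 * y + 0)).
      apply borel_preimage_affine; [lra | exact H2].
      apply set_ext. intros x. replace (/ 2 * x + 0) with (x / 2) by field. tauto.
    * intros i i' x Hi Hi' Hne. now apply Hdisj.
    * intros i x Hi Hx. specialize (Haf i (x / 2) Hi Hx).
      replace x with (2 * (x / 2)) by field. rewrite tent_double. lra.
  + rewrite <- sumR_scal. apply sumR_eq. intros i Hi. apply Hterm; eauto.
- intros [s [[n [b [B [HB [Hdisj [Hbf ->]]]]]] ->]].
  exists n, (fun i => b i / 2), (fun i x => B i (2 * x)).
  assert (HB' : forall i, (i < n)%nat -> 0 <= b i / 2 /\ borel (fun x => B i (2 * x))).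
  { intros i Hi. destruct (HB i Hi) as [H1 H2]. split; [lra|].
    replace (fun y => B i (2 * y)) with (fun y => B i (2 * y + 0)).
    apply borel_preimage_affine; [lra | exact H2].
    apply set_ext. intros x. rewrite Rplus_0_r. tauto. }
  assert (Hbf' : forall i x, (i < n)%nat -> B i (2 * x) -> b i / 2 <= left_tent x).
  { intros i x Hi Hx. specialize (Hbf i (2 * x) Hi Hx).
    rewrite tent_double in Hbf. lra. }
  split; [exact HB'|]. split; [|split; [exact Hbf'|]].
  + intros i i' x Hi Hi' Hne. now apply Hdisj.
  + rewrite <- sumR_scal. apply sumR_eq. intros i Hi. rewrite Hterm by eauto.
    f_equal. f_equal; [field|]. f_equal. apply set_ext. intros y.
    replace (2 * (y / 2)) with y by field. tauto.
Qed.

Lemma lintegral_left_tent (mu : set -> R) (k j : nat) :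
  is_measure mu -> 0 < mu (dyadic k j) -> 0 < mu (dyadic (S k) (2 * j)) ->
  lintegral (blowup mu k j) left_tent
  = mu (dyadic (S k) (2 * j)) / mu (dyadic k j) / 2
    * lintegral (blowup mu (S k) (2 * j)) tent.
Proof.
intros Hmu Hpos Hpos'.
set (c := mu (dyadic (S k) (2 * j)) / mu (dyadic k j) / 2).
assert (Hc : 0 < c) by (unfold c; repeat apply Rdiv_lt_0_compat; lra).
destruct (lintegral_blowup_lub mu k j left_tent 1) as [U1 L1];
  try assumption; try lra; [apply left_tent_bounds|].
destruct (lintegral_blowup_lub mu (S k) (2 * j) tent 1) as [U2 L2];
  try assumption; try lra; [apply tent_bounds|].
apply Rle_antisym.
- apply L1. intros r Hr. apply simple_sums_left_tent in Hr; try assumption.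
  destruct Hr as [s [Hs ->]]. apply Rmult_le_compat_l; [lra | now apply U2].
- apply Rmult_le_reg_l with (/ c); [now apply Rinv_0_lt_compat|].
  rewrite <- Rmult_assoc, Rinv_l, Rmult_1_l by lra.
  apply L2. intros s Hs. apply Rmult_le_reg_l with c; [exact Hc|].
  rewrite <- Rmult_assoc, Rinv_r, Rmult_1_l by lra.
  apply U1, simple_sums_left_tent; try assumption. exists s. now split.
Qed.

Definition splitting_ratio (mu : set -> R) (k j : nat) : R :=
  mu (dyadic (S k) (2 * j)) / mu (dyadic k j).

(** Let [p], [q] be the splitting ratios and [s], [t] the tent integrals on the left half. Testing
    with [left_tent] bounds [p s / 2 - q t / 2], testing the left half with [tent] bounds [s - t],
    and [(p - q) s] is a combination of the two. *)
Lemma splitting_ratio_tent_le_alpha (mu nu : set -> R) (k j : nat) :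
  is_measure mu -> is_measure nu ->
  0 < mu (dyadic k j) -> 0 < mu (dyadic (S k) (2 * j)) ->
  0 < nu (dyadic k j) -> 0 < nu (dyadic (S k) (2 * j)) ->
  splitting_ratio nu k j <= 1 ->
  Rabs (splitting_ratio mu k j - splitting_ratio nu k j)
    * lintegral (blowup mu (S k) (2 * j)) tent
  <= 2 * alpha mu nu k j + alpha mu nu (S k) (2 * j).
Proof.
intros Hmu Hnu Hm Hm' Hn Hn' Hq.
destruct (alpha_lub mu nu k j) as [U1 _]; try assumption.
destruct (alpha_lub mu nu (S k) (2 * j)) as [U2 _]; try assumption.
assert (H1 := U1 _ (ex_intro _ left_tent (conj lip1_supp01_left_tent eq_refl))).
assert (H2 := U2 _ (ex_intro _ tent (conj lip1_supp01_tent eq_refl))).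
rewrite !integral_nonneg_eq in H1 by (try assumption; apply left_tent_bounds).
rewrite !integral_nonneg_eq in H2 by (try assumption; apply tent_bounds).
rewrite !lintegral_left_tent in H1 by assumption.
fold (splitting_ratio mu k j) (splitting_ratio nu k j) in H1.
assert (Hq0 : 0 < splitting_ratio nu k j) by (now apply Rdiv_lt_0_compat).
destruct (lintegral_blowup_bounds mu (S k) (2 * j) tent 1) as [Hs0 _];
  try assumption; try lra; [apply tent_bounds|].
set (s := lintegral (blowup mu (S k) (2 * j)) tent) in *.
set (t := lintegral (blowup nu (S k) (2 * j)) tent) in *.
set (p := splitting_ratio mu k j) in *. set (q := splitting_ratio nu k j) in *.
rewrite <- (Rabs_right s) at 1 by lra. rewrite <- Rabs_mult.
replace ((p - q) * s) with (2 * (p / 2 * s - q / 2 * t) + - q * (s - t)) by field.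
eapply Rle_trans; [apply Rabs_triang|].
rewrite !Rabs_mult, (Rabs_right 2), Rabs_Ropp, (Rabs_right q) by lra.
apply Rplus_le_compat; [lra|].
apply Rle_trans with (1 * Rabs (s - t)); [|lra].
apply Rmult_le_compat_r; [apply Rabs_pos | exact Hq].
Qed.

(** * Consequences of doubling *)

Lemma lt_pow2_left (k j : nat) : (j < 2 ^ k)%nat -> (2 * j < 2 ^ S k)%nat.
Proof. cbn [Nat.pow]. lia. Qed.

Lemma lt_pow2_right (k j : nat) : (j < 2 ^ k)%nat -> (2 * j + 1 < 2 ^ S k)%nat.
Proof. cbn [Nat.pow]. lia. Qed.

Lemma div2_right (j : nat) : Nat.div2 (2 * j + 1) = j.
Proof. rewrite Nat.add_1_r. apply Nat.div2_succ_double. Qed.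

Lemma doubling_left (C0 : R) (mu : set -> R) (k j : nat) :
  dyadic_doubling C0 mu -> (j < 2 ^ k)%nat ->
  mu (dyadic k j) <= C0 * mu (dyadic (S k) (2 * j)).
Proof.
intros H Hj. generalize (H k _ (lt_pow2_left k j Hj)). now rewrite Nat.div2_double.
Qed.

Lemma doubling_right (C0 : R) (mu : set -> R) (k j : nat) :
  dyadic_doubling C0 mu -> (j < 2 ^ k)%nat ->
  mu (dyadic k j) <= C0 * mu (dyadic (S k) (2 * j + 1)).
Proof.
intros H Hj. generalize (H k _ (lt_pow2_right k j Hj)). now rewrite div2_right.
Qed.

Lemma doubling_pos (C0 : R) (mu : set -> R) :
  is_prob_on_01 mu -> 1 <= C0 -> dyadic_doubling C0 mu ->
  forall k j, (j < 2 ^ k)%nat -> 0 < mu (dyadic k j).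
Proof.
intros [Hmu [H1 H0]] HC HD. induction k as [|k IH]; intros j Hj.
- replace j with O by (cbn in Hj; lia).
  assert (E := measure_split mu _ (dyadic 0 0) Hmu borel_full (borel_dyadic 0 0)).
  rewrite H1 in E.
  replace (fun x => True /\ dyadic 0 0 x) with (dyadic 0 0) in E
    by (apply set_ext; tauto).
  replace (fun x => True /\ ~ dyadic 0 0 x) with (fun x => ~ (0 <= x < 1)) in E
    by (apply set_ext; intros x; rewrite dyadic_00_iff; tauto).
  lra.
- assert (H : 0 < mu (dyadic k (Nat.div2 j))).
  { apply IH. rewrite Nat.div2_div. apply Nat.Div0.div_lt_upper_bound.
    cbn [Nat.pow] in Hj. lia. }
  specialize (HD k j Hj).
  apply Rmult_lt_reg_l with C0; [lra|]. lra.
Qed.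

Lemma measure_children (mu : set -> R) (A : set) (k j : nat) :
  is_measure mu -> borel A ->
  mu (fun x => A x /\ dyadic k j x)
  = mu (fun x => A x /\ dyadic (S k) (2 * j) x)
    + mu (fun x => A x /\ dyadic (S k) (2 * j + 1) x).
Proof.
intros Hmu HA. rewrite <- measure_or; auto using borel_and, borel_dyadic.
- f_equal. apply set_ext. intros x. rewrite dyadic_split. tauto.
- intros x [_ H1] [_ H2]. pose proof (dyadic_inj _ _ _ _ H1 H2). lia.
Qed.

Lemma dyadic_children (mu : set -> R) (k j : nat) :
  is_measure mu ->
  mu (dyadic k j) = mu (dyadic (S k) (2 * j)) + mu (dyadic (S k) (2 * j + 1)).
Proof.
intros Hmu. generalize (measure_children mu (fun _ => True) k j Hmu borel_full).
assert (E : forall A : set, (fun x => True /\ A x) = A)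
  by (intros A; apply set_ext; tauto).
now rewrite !E.
Qed.

Lemma splitting_ratio_right (mu : set -> R) (k j : nat) :
  is_measure mu -> 0 < mu (dyadic k j) ->
  1 - splitting_ratio mu k j = mu (dyadic (S k) (2 * j + 1)) / mu (dyadic k j).
Proof.
intros Hmu Hpos. unfold splitting_ratio. pose proof (dyadic_children mu k j Hmu) as E.
apply Rmult_eq_reg_r with (mu (dyadic k j)); [|lra]. field_simplify; lra.
Qed.

Lemma splitting_ratio_bounds (C0 : R) (mu : set -> R) (k j : nat) :
  is_prob_on_01 mu -> 1 <= C0 -> dyadic_doubling C0 mu -> (j < 2 ^ k)%nat ->
  / C0 <= splitting_ratio mu k j <= 1 - / C0.
Proof.
intros Hmu HC HD Hj. pose proof (doubling_pos C0 mu Hmu HC HD k j Hj) as Hpos.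
assert (H2 : / C0 <= 1 - splitting_ratio mu k j).
{ rewrite splitting_ratio_right by (try assumption; apply Hmu).
  pose proof (doubling_right C0 mu k j HD Hj).
  apply Rmult_le_reg_r with (C0 * mu (dyadic k j)); [apply Rmult_lt_0_compat; lra|].
  field_simplify; lra. }
split; [|lra]. pose proof (doubling_left C0 mu k j HD Hj). unfold splitting_ratio.
apply Rmult_le_reg_r with (C0 * mu (dyadic k j)); [apply Rmult_lt_0_compat; lra|].
field_simplify; lra.
Qed.

(* The tent exceeds [1/4] on [[1/4, 1/2)], a grandchild of the unit interval. *)
Lemma tent_integral_lower_bound (C0 : R) (mu : set -> R) (k j : nat) :
  is_prob_on_01 mu -> 1 <= C0 -> dyadic_doubling C0 mu -> (j < 2 ^ k)%nat ->
  1 <= 4 * C0 ^ 2 * lintegral (blowup mu k j) tent.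
Proof.
intros Hmu HC HD Hj. pose proof (doubling_pos C0 mu Hmu HC HD k j Hj) as Hpos.
destruct (lintegral_blowup_lub mu k j tent 1) as [U _];
  [apply Hmu | exact Hpos | lra | apply tent_bounds |].
pose proof (doubling_left C0 mu k j HD Hj) as H1.
pose proof (doubling_right C0 mu _ _ HD (lt_pow2_left k j Hj)) as H2.
set (m := mu (dyadic (S (S k)) (2 * (2 * j) + 1))) in *.
assert (Hm : 1 / 4 * (m / mu (dyadic k j)) <= lintegral (blowup mu k j) tent).
{ apply U. exists 1%nat, (fun _ => 1 / 4), (fun _ => dyadic 2 1).
  split; [|split; [|split]].
  - intros _ _. split; [lra | apply borel_dyadic].
  - intros; lia.
  - intros _ x _ Hx. apply dyadic_iff in Hx. unfold T_dyadic in Hx. simpl in Hx.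
    unfold tent, Rmax, Rmin; repeat destruct Rle_dec; lra.
  - cbn [sumR]. rewrite blowup_eq by exact Hpos. unfold m.
    replace (fun x => dyadic k j x /\ dyadic 2 1 (T_dyadic k j x))
      with (dyadic (S (S k)) (2 * (2 * j) + 1)); [ring|].
    apply set_ext. intros x. rewrite dyadic_right_iff, T_dyadic_left, !dyadic_iff.
    assert (E : T_dyadic 2 1 (T_dyadic k j x) = 4 * T_dyadic k j x - 1)
      by (unfold T_dyadic at 1; simpl; ring).
    rewrite E. lra. }
apply Rle_trans with (4 * C0 ^ 2 * (1 / 4 * (m / mu (dyadic k j)))).
- apply Rmult_le_reg_r with (mu (dyadic k j)); [exact Hpos|].
  replace (4 * C0 ^ 2 * (1 / 4 * (m / mu (dyadic k j))) * mu (dyadic k j))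
    with (C0 * (C0 * m)) by (field; lra).
  assert (C0 * mu (dyadic (S k) (2 * j)) <= C0 * (C0 * m))
    by (apply Rmult_le_compat_l; lra). lra.
- apply Rmult_le_compat_l; [|exact Hm]. pose proof (pow2_ge_0 C0). lra.
Qed.

(** The factor [4 C0^2] comes from the lower bound on the tent integral. Squaring it gives
    [16 C0^4], and [(2 a + b)^2 <= 8 (a^2 + b^2)] supplies the remaining 8. *)
Lemma splitting_ratio_diff_sq (C0 : R) (mu nu : set -> R) (k j : nat) :
  is_prob_on_01 mu -> is_prob_on_01 nu -> 1 <= C0 ->
  dyadic_doubling C0 mu -> dyadic_doubling C0 nu -> (j < 2 ^ k)%nat ->
  (splitting_ratio mu k j - splitting_ratio nu k j) ^ 2
  <= 128 * C0 ^ 4 * (alpha mu nu k j ^ 2 + alpha mu nu (S k) (2 * j) ^ 2).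
Proof.
intros Hmu Hnu HC HDmu HDnu Hj. pose proof (lt_pow2_left k j Hj) as Hj'.
assert (H := splitting_ratio_tent_le_alpha mu nu k j (proj1 Hmu) (proj1 Hnu)
  (doubling_pos C0 mu Hmu HC HDmu k j Hj) (doubling_pos C0 mu Hmu HC HDmu _ _ Hj')
  (doubling_pos C0 nu Hnu HC HDnu k j Hj) (doubling_pos C0 nu Hnu HC HDnu _ _ Hj')).
pose proof (splitting_ratio_bounds C0 nu k j Hnu HC HDnu Hj) as Hq.
assert (HiC : 0 < / C0) by (apply Rinv_0_lt_compat; lra).
specialize (H ltac:(lra)).
pose proof (tent_integral_lower_bound C0 mu _ _ Hmu HC HDmu Hj') as Ht.
set (s := lintegral _ _) in *. set (a := alpha mu nu k j) in *.
set (b := alpha mu nu (S k) (2 * j)) in *.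
set (d := splitting_ratio mu k j - splitting_ratio nu k j) in *.
assert (Hd := Rabs_pos d). rewrite <- (pow2_abs d).
assert (H1 : Rabs d <= 4 * C0 ^ 2 * (2 * a + b)).
{ apply Rle_trans with (Rabs d * (4 * C0 ^ 2 * s)).
  - rewrite <- (Rmult_1_r (Rabs d)) at 1. now apply Rmult_le_compat_l.
  - replace (Rabs d * (4 * C0 ^ 2 * s)) with (4 * C0 ^ 2 * (Rabs d * s)) by ring.
    apply Rmult_le_compat_l; [|exact H]. pose proof (pow2_ge_0 C0). lra. }
apply Rle_trans with ((4 * C0 ^ 2 * (2 * a + b)) ^ 2).
- apply pow_incr. lra.
- replace ((4 * C0 ^ 2 * (2 * a + b)) ^ 2) with (16 * C0 ^ 4 * (2 * a + b) ^ 2) by ring.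
  replace (128 * C0 ^ 4 * (a ^ 2 + b ^ 2))
    with (16 * C0 ^ 4 * (8 * (a ^ 2 + b ^ 2))) by ring.
  apply Rmult_le_compat_l; [assert (0 <= C0 ^ 4) by (apply pow_le; lra); lra|].
  nra.
Qed.

(** * Carleson sums as sums over finite binary trees *)

(** Unlike the sum by generations in [carleson_partial], this form splits by definition into an
    interval and its two halves, as the induction in [level_set_estimate] requires. *)
Fixpoint tree_sum (g : nat -> nat -> R) (n k j : nat) : R :=
  match n with
  | O => 0
  | S n' => g k j + tree_sum g n' (S k) (2 * j) + tree_sum g n' (S k) (2 * j + 1)
  end.

Lemma tree_sum_ge0 (g : nat -> nat -> R) :
  (forall k j, 0 <= g k j) -> forall n k j, 0 <= tree_sum g n k j.
Proof.
intros Hg. induction n as [|n IH]; intros k j; cbn [tree_sum]; [lra|].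
pose proof (Hg k j). pose proof (IH (S k) (2 * j)%nat).
pose proof (IH (S k) (2 * j + 1)%nat). lra.
Qed.

Lemma tree_sum_le_root (g : nat -> nat -> R) :
  (forall k j, 0 <= g k j) ->
  forall k n j, (j < 2 ^ k)%nat -> tree_sum g n k j <= tree_sum g (n + k) 0 0.
Proof.
intros Hg. induction k as [|k IH]; intros n j Hj.
- replace j with O by (cbn in Hj; lia). rewrite Nat.add_0_r. lra.
- assert (Hj' : (Nat.div2 j < 2 ^ k)%nat).
  { rewrite Nat.div2_div. apply Nat.Div0.div_lt_upper_bound. cbn [Nat.pow] in Hj. lia. }
  specialize (IH (S n) _ Hj'). replace (S n + k)%nat with (n + S k)%nat in IH by lia.
  eapply Rle_trans; [|exact IH]. cbn [tree_sum].
  pose proof (Hg k (Nat.div2 j)).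
  pose proof (tree_sum_ge0 g Hg n (S k) (2 * Nat.div2 j)).
  pose proof (tree_sum_ge0 g Hg n (S k) (2 * Nat.div2 j + 1)).
  destruct (Nat.Even_or_Odd j) as [[i ->]|[i ->]].
  + rewrite Nat.div2_double in *. lra.
  + rewrite div2_right in *. lra.
Qed.

Lemma sumR_cat (a b : nat) (f : nat -> R) :
  sumR (a + b) f = sumR a f + sumR b (fun i => f (a + i)%nat).
Proof.
induction b as [|b IH]; [rewrite Nat.add_0_r; cbn; ring|].
rewrite Nat.add_succ_r. cbn. rewrite IH. ring.
Qed.

(** The descendants of [j] after [n] generations are numbered [j 2^n + l] with [l < 2^n]. This links
    the recursive form to the sum by generations. *)
Lemma tree_sum_last_level (g : nat -> nat -> R) (n k j : nat) :
  tree_sum g (S n) k j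
  = tree_sum g n k j + sumR (2 ^ n) (fun l => g (k + n) (j * 2 ^ n + l))%nat.
Proof.
revert k j. induction n as [|n IH]; intros k j.
- cbn. rewrite Nat.mul_1_r, !Nat.add_0_r. ring.
- change (tree_sum g (S (S n)) k j)
    with (g k j + tree_sum g (S n) (S k) (2 * j) + tree_sum g (S n) (S k) (2 * j + 1)).
  rewrite (IH (S k) (2 * j)%nat), (IH (S k) (2 * j + 1)%nat). cbn [tree_sum].
  replace (2 ^ S n)%nat with (2 ^ n + 2 ^ n)%nat by (cbn [Nat.pow]; lia).
  rewrite sumR_cat.
  rewrite (sumR_eq _ (fun l => g (k + S n)%nat (j * (2 ^ n + 2 ^ n) + l)%nat)
             (fun l => g (S k + n)%nat (2 * j * 2 ^ n + l)%nat))
    by (intros i _; f_equal; nia).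
  rewrite (sumR_eq _ (fun l => g (k + S n)%nat (j * (2 ^ n + 2 ^ n) + (2 ^ n + l))%nat)
             (fun l => g (S k + n)%nat ((2 * j + 1) * 2 ^ n + l)%nat))
    by (intros i _; f_equal; nia).
  ring.
Qed.

Lemma tree_sum_root (g : nat -> nat -> R) (n : nat) :
  tree_sum g n 0 0 = sumR n (fun k => sumR (2 ^ k) (g k)).
Proof.
induction n as [|n IH]; [reflexivity|].
rewrite tree_sum_last_level, IH. reflexivity.
Qed.

Definition alpha_weight (mu nu : set -> R) (k j : nat) : R :=
  alpha mu nu k j ^ 2 * mu (dyadic k j).

Lemma alpha_weight_ge0 (mu nu : set -> R) (k j : nat) :
  is_measure mu -> 0 <= alpha_weight mu nu k j.
Proof.
intros Hmu. apply Rmult_le_pos; [apply pow2_ge_0|].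
apply measure_ge0; auto using borel_dyadic.
Qed.

Lemma tree_sum_le_carleson_partial (mu nu : set -> R) (n k j : nat) :
  is_measure mu -> (j < 2 ^ k)%nat ->
  tree_sum (alpha_weight mu nu) n k j <= carleson_partial mu nu k j (n + k).
Proof.
intros Hmu Hj.
(* The weight extended by zero outside the interval; its tree sum from the root is the Carleson
   sum. *)
set (G := fun k' j' =>
  if excluded_middle_informative (included_set (dyadic k' j') (dyadic k j))
  then alpha mu nu k' j' ^ 2 * mu (dyadic k' j') else 0).
assert (HG : forall k' j', 0 <= G k' j').
{ intros k' j'. unfold G.
  destruct excluded_middle_informative; [now apply alpha_weight_ge0 | lra]. }
assert (E : carleson_partial mu nu k j (n + k) = tree_sum G (S n + k) 0 0).
{ rewrite tree_sum_root. reflexivity. }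
rewrite E.
assert (E' : forall m k' j', included_set (dyadic k' j') (dyadic k j) ->
             tree_sum (alpha_weight mu nu) m k' j' = tree_sum G m k' j').
{ induction m as [|m IH]; intros k' j' Hincl; cbn [tree_sum]; [reflexivity|].
  f_equal; [f_equal|].
  - unfold G. destruct excluded_middle_informative; [reflexivity | contradiction].
  - apply IH. intros x Hx. apply Hincl, dyadic_split. now left.
  - apply IH. intros x Hx. apply Hincl, dyadic_split. now right. }
rewrite E' by (intros x Hx; exact Hx).
(* [carleson_partial] at [n + k] includes generation [n + k] itself, one more than a tree of depth
   [n] below generation [k]. *)
apply Rle_trans with (tree_sum G (S n) k j).
- rewrite tree_sum_last_level.
  assert (H : sumR (2 ^ n) (fun _ => 0)
              <= sumR (2 ^ n) (fun l => G (k + n) (j * 2 ^ n + l))%nat)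
    by (apply sumR_le; auto).
  assert (H0 : sumR (2 ^ n) (fun _ => 0) = 0).
  { generalize (2 ^ n)%nat. induction n0 as [|i IHi]; cbn; [reflexivity|].
    rewrite IHi. ring. }
  lra.
- now apply tree_sum_le_root.
Qed.

Definition ratio_weight (mu nu : set -> R) (k j : nat) : R :=
  (splitting_ratio mu k j - splitting_ratio nu k j) ^ 2 * mu (dyadic k j).

(** Doubling replaces the mass of an interval by [C0] times that of its left half, turning the
    second [alpha] into a weight one generation lower. The shifted weights form a tree one
    generation deeper without its root, hence the factor [1 + C0]. *)
Lemma ratio_weight_carleson (mu nu : set -> R) (C0 C : R) :
  is_prob_on_01 mu -> is_prob_on_01 nu -> 1 <= C0 ->
  dyadic_doubling C0 mu -> dyadic_doubling C0 nu ->
  (forall k j, (j < 2 ^ k)%nat ->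
     forall N, carleson_partial mu nu k j N <= C * mu (dyadic k j)) ->
  forall n k j, (j < 2 ^ k)%nat ->
  tree_sum (ratio_weight mu nu) n k j
  <= 128 * C0 ^ 4 * (1 + C0) * C * mu (dyadic k j).
Proof.
intros Hmu Hnu HC HDmu HDnu Hcarl n k j Hj.
set (w := alpha_weight mu nu). set (D := 128 * C0 ^ 4).
assert (HD : 0 <= D) by (unfold D; assert (0 <= C0 ^ 4) by (apply pow_le; lra); lra).
assert (Hw : forall k j, 0 <= w k j) by (intros; now apply alpha_weight_ge0, Hmu).
assert (Hwt : forall k j, (j < 2 ^ k)%nat ->
          ratio_weight mu nu k j <= D * (w k j + C0 * w (S k) (2 * j)%nat)).
{ clear n k j Hj. intros k j Hj. unfold ratio_weight, w, alpha_weight.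
  pose proof (splitting_ratio_diff_sq C0 mu nu k j Hmu Hnu HC HDmu HDnu Hj) as H.
  pose proof (doubling_left C0 mu k j HDmu Hj) as H1.
  pose proof (doubling_pos C0 mu Hmu HC HDmu k j Hj) as H2.
  set (m := mu (dyadic k j)) in *. set (m' := mu (dyadic (S k) (2 * j))) in *.
  set (a := alpha mu nu k j) in *. set (b := alpha mu nu (S k) (2 * j)) in *.
  eapply Rle_trans; [apply Rmult_le_compat_r; [lra | exact H]|]. fold D.
  rewrite Rmult_assoc. apply Rmult_le_compat_l; [exact HD|].
  assert (b ^ 2 * m <= b ^ 2 * (C0 * m'))
    by (apply Rmult_le_compat_l; [apply pow2_ge_0 | exact H1]).
  lra. }
assert (Htree : forall n k j, (j < 2 ^ k)%nat ->
  tree_sum (ratio_weight mu nu) n k j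
  <= D * (tree_sum w n k j + C0 * (tree_sum w (S n) k j - w k j))).
{ clear n k j Hj. induction n as [|n IH]; intros k j Hj.
  - cbn [tree_sum]. right. ring.
  - assert (H1 := IH _ _ (lt_pow2_left k j Hj)).
    assert (H2 := IH _ _ (lt_pow2_right k j Hj)).
    specialize (Hwt k j Hj).
    remember (S n) as n'. cbn [tree_sum]. subst n'.
    change (tree_sum (ratio_weight mu nu) (S n) k j)
      with (ratio_weight mu nu k j + tree_sum (ratio_weight mu nu) n (S k) (2 * j)
            + tree_sum (ratio_weight mu nu) n (S k) (2 * j + 1)).
    change (tree_sum w (S n) k j)
      with (w k j + tree_sum w n (S k) (2 * j) + tree_sum w n (S k) (2 * j + 1)).
    (* The rootless tree also contains the weight of the right half, which the bound for this
       interval does not use up. *)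
    assert (0 <= D * (C0 * w (S k) (2 * j + 1)%nat)).
    { apply Rmult_le_pos; [exact HD|]. apply Rmult_le_pos; [lra | apply Hw]. }
    lra. }
eapply Rle_trans; [now apply Htree|].
assert (H1 := tree_sum_le_carleson_partial mu nu n k j (proj1 Hmu) Hj).
assert (H2 := tree_sum_le_carleson_partial mu nu (S n) k j (proj1 Hmu) Hj).
fold w in H1, H2.
pose proof (Hcarl k j Hj (n + k)%nat). pose proof (Hcarl k j Hj (S n + k)%nat).
pose proof (Hw k j).
replace (D * (1 + C0) * C * mu (dyadic k j))
  with (D * (C * mu (dyadic k j) + C0 * (C * mu (dyadic k j)))) by ring.
apply Rmult_le_compat_l; [exact HD|]. apply Rplus_le_compat; [lra|].
apply Rmult_le_compat_l; lra.
Qed.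

(** * The Bellman function argument *)

Lemma ln_le_sub1 (r : R) : 0 < r -> ln r <= r - 1.
Proof.
intros Hr. destruct (Req_dec r 1) as [->|Hne]; [rewrite ln_1; lra|].
assert (Hln : ln r <> 0).
{ intros H. apply Hne. apply ln_inv; [exact Hr | lra | now rewrite ln_1]. }
pose proof (exp_ineq1 (ln r) Hln) as H. rewrite exp_ln in H by exact Hr. lra.
Qed.

(** The weighted inequality of arithmetic and geometric means for [r] and 1, with weights [eps] and
    [1 - eps]. *)
Lemma Rpower_le_tangent (r eps : R) :
  0 < r -> 0 < eps <= 1 -> Rpower r eps <= 1 + eps * (r - 1).
Proof.
intros Hr Heps. set (t := 1 + eps * (r - 1)).
assert (Ht : 0 < t) by (unfold t; destruct (Rle_lt_dec 1 r); nra).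
unfold Rpower. rewrite <- (exp_ln t Ht).
assert (H : eps * ln r <= ln t).
(* Jensen's inequality through the tangent of [ln] at the mean [t]: with these weights the linear
   terms cancel. *)
{ assert (H1 := ln_le_sub1 (r / t) (Rdiv_lt_0_compat _ _ Hr Ht)).
  assert (H2 := ln_le_sub1 (1 / t) (Rdiv_lt_0_compat _ _ Rlt_0_1 Ht)).
  unfold Rdiv in H1, H2.
  rewrite ln_mult, ln_Rinv in H1 by auto using Rinv_0_lt_compat.
  rewrite Rmult_1_l, ln_Rinv in H2 by exact Ht.
  apply Rmult_le_compat_l with (r := eps) in H1; [|lra].
  apply Rmult_le_compat_l with (r := 1 - eps) in H2; [|lra].
  assert (E : eps * (r * / t - 1) + (1 - eps) * (/ t - 1) = 0)
    by (unfold t in *; field; lra).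
  lra. }
destruct (Rle_lt_or_eq_dec _ _ H) as [H'|H'].
- left. now apply exp_increasing.
- right. now rewrite H'.
Qed.

(** Stated with [/ r] so that for [r = (1 - p) / (1 - q)] the denominator [1 - p] cancels against
    the weight of the right half. *)
Lemma Rpower_ge_tangent (r eps : R) :
  0 < r -> 0 < eps -> 1 - eps * (/ r - 1) <= Rpower r eps.
Proof.
intros Hr Heps. unfold Rpower.
apply Rle_trans with (1 + eps * ln r); [|apply exp_ineq1_le].
pose proof (ln_le_sub1 (/ r) (Rinv_0_lt_compat _ Hr)) as H.
rewrite ln_Rinv in H by exact Hr.
apply Rmult_le_compat_l with (r := eps) in H; lra.
Qed.

Definition bellman (K M : R) : R := 1 + (2 * K + 1) * M - M ^ 2.

(** An upper bound for [bellman K] on [0, K], not its maximum: the negative square is dropped. *)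
Definition bellman_max (K : R) : R := 1 + (2 * K + 1) * K.

Lemma bellman_bounds (K M : R) : 0 <= M <= K -> 1 <= bellman K M <= bellman_max K.
Proof. unfold bellman, bellman_max. nra. Qed.

(* [p] and [q] are the splitting ratios, [X] and [Y] the normalised Carleson sums of the two
   children. The slope of [bellman K], at least [1] on [[0, K]], yields a gain of [(p - q)^2] and
   its concavity a gain of [p (1 - p) (X - Y)^2]; for small [eps] these absorb the second-order
   and the mixed error terms. *)
Lemma bellman_step (C0 K eps p q X Y : R) :
  1 <= C0 -> 0 < eps <= 1 -> 4 * C0 * bellman_max K * eps <= 1 ->
  C0 ^ 2 * (2 * K + 1) * eps <= 1 ->
  / C0 <= p <= 1 - / C0 -> / C0 <= q <= 1 - / C0 ->
  0 <= X <= K -> 0 <= Y <= K -> (p - q) ^ 2 + p * X + (1 - p) * Y <= K ->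
  p * Rpower (p / q) eps * bellman K X
  + (1 - p) * Rpower ((1 - p) / (1 - q)) eps * bellman K Y
  <= bellman K ((p - q) ^ 2 + p * X + (1 - p) * Y).
Proof.
intros HC Heps Hsmall1 Hsmall2 Hp Hq HX HY HM.
assert (HiC : 0 < / C0) by (apply Rinv_0_lt_compat; lra).
assert (HCi : C0 * / C0 = 1) by (apply Rinv_r; lra).
set (D := p - q) in *. set (d := Y - X).
set (s := Rpower (p / q) eps - 1). set (t := Rpower ((1 - p) / (1 - q)) eps - 1).
assert (Hq1 : / q <= C0) by (rewrite <- (Rinv_inv C0); apply Rinv_le_contravar; lra).
assert (Hq2 : / (1 - q) <= C0)
  by (rewrite <- (Rinv_inv C0); apply Rinv_le_contravar; lra).
assert (Hq3 : 0 < / (1 - q)) by (apply Rinv_0_lt_compat; lra).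
assert (HD := Rabs_pos D). assert (Hd := Rabs_pos d).
assert (HDle := Rle_abs D). assert (HDge := Rle_abs (- D)). rewrite Rabs_Ropp in HDge.
assert (Hs : s <= eps * (p / q - 1)).
{ unfold s. assert (H := Rpower_le_tangent (p / q) eps).
  specialize (H ltac:(apply Rdiv_lt_0_compat; lra) Heps). lra. }
assert (Ht : t <= eps * ((1 - p) / (1 - q) - 1)).
{ unfold t. assert (H := Rpower_le_tangent ((1 - p) / (1 - q)) eps).
  specialize (H ltac:(apply Rdiv_lt_0_compat; lra) Heps). lra. }
assert (Ht' : - eps * ((1 - q) / (1 - p) - 1) <= t).
{ unfold t. assert (H := Rpower_ge_tangent ((1 - p) / (1 - q)) eps).
  specialize (H ltac:(apply Rdiv_lt_0_compat; lra) ltac:(lra)).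
  rewrite Rinv_div in H. lra. }
(* The mean of the tangent bounds is [eps] times the chi-squared distance between (p, 1 - p) and (q,
   1 - q), hence quadratic in [D]. *)
assert (Hmean : p * s + (1 - p) * t <= 2 * C0 * eps * D ^ 2).
{ apply Rle_trans with (eps * (D ^ 2 * (/ q + / (1 - q)))).
  - apply Rmult_le_compat_l with (r := p) in Hs; [|lra].
    apply Rmult_le_compat_l with (r := 1 - p) in Ht; [|lra].
    replace (eps * (D ^ 2 * (/ q + / (1 - q))))
      with (p * (eps * (p / q - 1)) + (1 - p) * (eps * ((1 - p) / (1 - q) - 1)))
      by (unfold D; field; lra).
    lra.
  - replace (2 * C0 * eps * D ^ 2) with (eps * (D ^ 2 * (2 * C0))) by ring.
    apply Rmult_le_compat_l; [lra|].
    apply Rmult_le_compat_l; [apply pow2_ge_0 | lra]. }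
(* A single half carries an error that is only linear in [D]; both signs are needed because it
   multiplies a difference of unknown sign. *)
assert (Habs : Rabs ((1 - p) * t) <= eps * C0 * Rabs D).
{ apply Rabs_le. split.
  - apply Rle_trans with (- (eps * D)).
    + assert (D <= C0 * Rabs D) by nra. nra.
    + apply Rmult_le_compat_l with (r := 1 - p) in Ht'; [|lra].
      replace (- (eps * D)) with ((1 - p) * (- eps * ((1 - q) / (1 - p) - 1)))
        by (unfold D; field; lra).
      exact Ht'.
  - apply Rle_trans with ((1 - p) * (eps * ((1 - p) / (1 - q) - 1))).
    + apply Rmult_le_compat_l; lra.
    + replace ((1 - p) * (eps * ((1 - p) / (1 - q) - 1)))
        with (eps * ((1 - p) * / (1 - q) * (- D))) by (unfold D; field; lra).
      rewrite (Rmult_assoc eps C0). apply Rmult_le_compat_l; [lra|].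
      apply Rle_trans with ((1 - p) * / (1 - q) * Rabs D).
      * apply Rmult_le_compat_l; [nra | exact HDge].
      * apply Rmult_le_compat_r; [exact HD | nra]. }
assert (HbX := bellman_bounds K X HX).
assert (Herr1 : bellman K X * (p * s + (1 - p) * t) <= / 2 * D ^ 2).
{ apply Rle_trans with (bellman K X * (2 * C0 * eps * D ^ 2)).
  - apply Rmult_le_compat_l; lra.
  - assert (H2 := pow2_ge_0 D).
    assert (H3 : bellman K X * (2 * C0 * eps) <= / 2).
    { apply Rle_trans with (bellman_max K * (2 * C0 * eps)); [|lra].
      apply Rmult_le_compat_r; [nra | lra]. }
    apply Rmult_le_compat_r with (r := D ^ 2) in H3; lra. }
(* The smallness of [eps] bounds the product by [|D| |d| / C0]; completing the square and
   [p (1 - p) >= 1 / C0^2] then separate [D] from [d]. *)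
assert (Herr2 : (1 - p) * t * (bellman K Y - bellman K X)
                <= / 2 * D ^ 2 + p * (1 - p) * d ^ 2).
{ eapply Rle_trans; [apply Rle_abs|]. rewrite Rabs_mult.
  assert (H1 : Rabs (bellman K Y - bellman K X) <= (2 * K + 1) * Rabs d).
  { replace (bellman K Y - bellman K X) with (d * (2 * K + 1 - X - Y))
      by (unfold bellman, d; ring).
    rewrite Rabs_mult, Rmult_comm. apply Rmult_le_compat_r; [exact Hd|].
    rewrite Rabs_right; lra. }
  apply Rle_trans with (eps * C0 * Rabs D * ((2 * K + 1) * Rabs d)).
  { apply Rmult_le_compat; auto using Rabs_pos. }
  assert (H2 : eps * C0 * (2 * K + 1) <= / C0).
  { apply Rmult_le_reg_l with C0; [lra|]. rewrite HCi. lra. }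
  apply Rle_trans with (/ C0 * (Rabs D * Rabs d)).
  { replace (eps * C0 * Rabs D * ((2 * K + 1) * Rabs d))
      with (eps * C0 * (2 * K + 1) * (Rabs D * Rabs d)) by ring.
    apply Rmult_le_compat_r; [now apply Rmult_le_pos | exact H2]. }
  assert (H3 : / C0 * / C0 <= p * (1 - p)) by (apply Rmult_le_compat; lra).
  rewrite <- (pow2_abs D), <- (pow2_abs d).
  apply Rmult_le_compat_r with (r := Rabs d ^ 2) in H3; [|apply pow2_ge_0].
  assert (H4 := pow2_ge_0 (Rabs D - / C0 * Rabs d)).
  assert (H5 := pow2_ge_0 (/ C0 * Rabs d)). lra. }
set (Mbar := p * X + (1 - p) * Y).
assert (HMbar : 0 <= Mbar) by (unfold Mbar; nra).
replace (D ^ 2 + p * X + (1 - p) * Y) with (D ^ 2 + Mbar) in * by (unfold Mbar; ring).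
(* The increment is [D^2 (2 K + 1 - 2 Mbar - D^2)], and [Mbar + D^2 <= K] makes the bracket at least
   1. *)
assert (Hgain : bellman K Mbar + D ^ 2 <= bellman K (D ^ 2 + Mbar)).
{ assert (H2 := pow2_ge_0 D). unfold bellman. nra. }
assert (Hconc : p * bellman K X + (1 - p) * bellman K Y + p * (1 - p) * d ^ 2
                = bellman K Mbar) by (unfold bellman, Mbar, d; ring).
replace (Rpower (p / q) eps) with (1 + s) by (unfold s; ring).
replace (Rpower ((1 - p) / (1 - q)) eps) with (1 + t) by (unfold t; ring).
(* Writing [bellman K Y] as [bellman K X] plus a difference makes the mean of [s] and [t] appear,
   leaving [t] alone only against that difference. *)
replace (p * (1 + s) * bellman K X + (1 - p) * (1 + t) * bellman K Y)
  with (p * bellman K X + (1 - p) * bellman K Y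
        + bellman K X * (p * s + (1 - p) * t)
        + (1 - p) * t * (bellman K Y - bellman K X)) by ring.
lra.
Qed.

(* Induction on the number of generations between the interval and the level of [F]; the case
   [n = 0] only distinguishes whether the density [mu/nu] of the interval is at most [c]. *)
Lemma level_set_estimate (mu nu : set -> R) (C0 K eps c : R) :
  is_prob_on_01 mu -> is_prob_on_01 nu -> 1 <= C0 ->
  dyadic_doubling C0 mu -> dyadic_doubling C0 nu ->
  0 < eps <= 1 -> 4 * C0 * bellman_max K * eps <= 1 ->
  C0 ^ 2 * (2 * K + 1) * eps <= 1 ->
  (forall n k j, (j < 2 ^ k)%nat ->
     tree_sum (ratio_weight mu nu) n k j <= K * mu (dyadic k j)) ->
  0 < c ->
  forall n k j F, (j < 2 ^ k)%nat -> borel F -> level_set (k + n) F ->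
  mu (fun x => F x /\ dyadic k j x)
  <= c * nu (fun x => F x /\ dyadic k j x)
     + mu (dyadic k j) * Rpower (mu (dyadic k j) / (c * nu (dyadic k j))) eps
       * bellman K (tree_sum (ratio_weight mu nu) n k j / mu (dyadic k j)).
Proof.
intros Hmu Hnu HC HDmu HDnu Heps Hs1 Hs2 HK Hc.
assert (Hpm := doubling_pos C0 mu Hmu HC HDmu).
assert (Hpn := doubling_pos C0 nu Hnu HC HDnu).
assert (Mmu := proj1 Hmu). assert (Mnu := proj1 Hnu).
assert (Hw : forall k j, 0 <= ratio_weight mu nu k j).
{ intros k j. apply Rmult_le_pos; [apply pow2_ge_0|].
  apply measure_ge0; auto using borel_dyadic. }
assert (HM : forall n k j, (j < 2 ^ k)%nat ->
  0 <= tree_sum (ratio_weight mu nu) n k j / mu (dyadic k j) <= K).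
{ intros n k j Hj. specialize (Hpm k j Hj). split.
  - apply Rmult_le_pos; [now apply tree_sum_ge0 | now apply Rlt_le, Rinv_0_lt_compat].
  - apply Rmult_le_reg_r with (mu (dyadic k j)); [exact Hpm|].
    unfold Rdiv. rewrite Rmult_assoc, Rinv_l, Rmult_1_r by lra. now apply HK. }
induction n as [|n IH]; intros k j F Hj HF HFl.
- rewrite Nat.add_0_r in HFl. cbn [tree_sum].
  specialize (Hpm k j Hj). specialize (Hpn k j Hj).
  assert (Hb : bellman K (0 / mu (dyadic k j)) = 1)
    by (unfold bellman; field; lra).
  rewrite Hb, Rmult_1_r.
  set (r := mu (dyadic k j) / (c * nu (dyadic k j))).
  assert (Hcn : 0 < c * nu (dyadic k j)) by (now apply Rmult_lt_0_compat).
  assert (Hr : 0 < r) by (now apply Rdiv_lt_0_compat).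
  assert (HR : 0 < Rpower r eps) by (unfold Rpower; apply exp_pos).
  assert (Hrest : 0 <= mu (dyadic k j) * Rpower r eps) by (apply Rmult_le_pos; lra).
  destruct (classic (exists x, F x /\ dyadic k j x)) as [[x [HFx Hx]]|Hne].
  + replace (fun x => F x /\ dyadic k j x) with (dyadic k j).
    2:{ apply set_ext. intros y; split; [|tauto].
        intros Hy; split; [exact (HFl j x y Hx Hy HFx) | exact Hy]. }
    destruct (Rle_lt_dec (mu (dyadic k j)) (c * nu (dyadic k j))) as [H|H]; [lra|].
    assert (H1 : 1 <= Rpower r eps).
    { assert (1 < r).
      { apply Rmult_lt_reg_r with (c * nu (dyadic k j)); [exact Hcn|].
        unfold r, Rdiv. rewrite Rmult_assoc, Rinv_l, Rmult_1_r by lra. lra. }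
      assert (/ r < 1) by (rewrite <- Rinv_1; apply Rinv_lt_contravar; lra).
      pose proof (Rpower_ge_tangent r eps Hr (proj1 Heps)). nra. }
    apply Rmult_le_compat_l with (r := mu (dyadic k j)) in H1; lra.
  + replace (fun x => F x /\ dyadic k j x) with (fun _ : R => False)
      by (apply set_ext; intros x; split; [tauto | intros H; apply Hne; eauto]).
    rewrite (proj1 Mmu), (proj1 Mnu). lra.
- assert (Hjl := lt_pow2_left k j Hj). assert (Hjr := lt_pow2_right k j Hj).
  assert (Hl := IH (S k) (2 * j)%nat F Hjl HF).
  assert (Hr := IH (S k) (2 * j + 1)%nat F Hjr HF).
  replace (S k + n)%nat with (k + S n)%nat in Hl, Hr by lia.
  specialize (Hl HFl). specialize (Hr HFl). clear IH.
  rewrite (measure_children mu F k j Mmu HF), (measure_children nu F k j Mnu HF).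
  assert (Bp := splitting_ratio_bounds C0 mu k j Hmu HC HDmu Hj).
  assert (Bq := splitting_ratio_bounds C0 nu k j Hnu HC HDnu Hj).
  assert (Ep := splitting_ratio_right mu k j Mmu (Hpm k j Hj)).
  assert (Eq := splitting_ratio_right nu k j Mnu (Hpn k j Hj)).
  assert (Ep' : splitting_ratio mu k j = mu (dyadic (S k) (2 * j)) / mu (dyadic k j))
    by reflexivity.
  assert (Eq' : splitting_ratio nu k j = nu (dyadic (S k) (2 * j)) / nu (dyadic k j))
    by reflexivity.
  assert (HMl := HM n _ _ Hjl). assert (HMr := HM n _ _ Hjr).
  assert (HMI := HM (S n) _ _ Hj).
  assert (Pm := Hpm k j Hj). assert (Pn := Hpn k j Hj).
  assert (Pml := Hpm _ _ Hjl). assert (Pnl := Hpn _ _ Hjl).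
  assert (Pmr := Hpm _ _ Hjr). assert (Pnr := Hpn _ _ Hjr).
  set (p := splitting_ratio mu k j) in *. set (q := splitting_ratio nu k j) in *.
  set (Sl := tree_sum (ratio_weight mu nu) n (S k) (2 * j)) in *.
  set (Sr := tree_sum (ratio_weight mu nu) n (S k) (2 * j + 1)) in *.
  set (m := mu (dyadic k j)) in *. set (v := nu (dyadic k j)) in *.
  set (ml := mu (dyadic (S k) (2 * j))) in *.
  set (vl := nu (dyadic (S k) (2 * j))) in *.
  set (mr := mu (dyadic (S k) (2 * j + 1))) in *.
  set (vr := nu (dyadic (S k) (2 * j + 1))) in *.
  set (X := Sl / ml) in *. set (Y := Sr / mr) in *.
  assert (Eml : ml = p * m) by (rewrite Ep'; field; lra).
  assert (Emr : mr = (1 - p) * m) by (rewrite Ep; field; lra).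
  assert (Evl : vl = q * v) by (rewrite Eq'; field; lra).
  assert (Evr : vr = (1 - q) * v) by (rewrite Eq; field; lra).
  change (tree_sum (ratio_weight mu nu) (S n) k j) with ((p - q) ^ 2 * m + Sl + Sr) in *.
  assert (EM : ((p - q) ^ 2 * m + Sl + Sr) / m = (p - q) ^ 2 + p * X + (1 - p) * Y).
  { unfold X, Y. rewrite Ep, Ep'. field. lra. }
  rewrite EM in HMI |- *.
  assert (Hstep := bellman_step C0 K eps p q X Y HC Heps Hs1 Hs2 Bp Bq HMl HMr (proj2 HMI)).
  assert (HiC : 0 < / C0) by (apply Rinv_0_lt_compat; lra).
  assert (Pr : 0 < m / (c * v))
    by (apply Rdiv_lt_0_compat; [|apply Rmult_lt_0_compat]; lra).
  (* The density of a half is that of the interval times the quotient of the splitting ratios, so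
     the power for the whole interval factors out and [bellman_step] applies to the rest. *)
  replace (ml / (c * vl)) with (m / (c * v) * (p / q)) in Hl
    by (rewrite Eml, Evl; field; lra).
  replace (mr / (c * vr)) with (m / (c * v) * ((1 - p) / (1 - q))) in Hr
    by (rewrite Emr, Evr; field; lra).
  rewrite <- Rpower_mult_distr in Hl, Hr by (try exact Pr; apply Rdiv_lt_0_compat; lra).
  assert (HP : 0 < Rpower (m / (c * v)) eps) by (unfold Rpower; apply exp_pos).
  set (P := Rpower (m / (c * v)) eps) in *.
  apply Rmult_le_compat_l with (r := m * P) in Hstep; [|apply Rmult_le_pos; lra].
  rewrite Eml in Hl. rewrite Emr in Hr. lra.
Qed.

(** * Passage to Borel sets and choice of the constants *)

Lemma Rle_of_le_plus_eps (a b M : R) :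
  (forall eta, 0 < eta -> a <= b + M * eta) -> a <= b.
Proof.
intros H. apply Rnot_lt_le. intros Hab.
set (N := Rabs M + 1).
assert (HN : 0 < N) by (pose proof (Rabs_pos M); unfold N; lra).
assert (Hd : 0 < (a - b) / (2 * N)) by (apply Rdiv_lt_0_compat; lra).
specialize (H _ Hd).
assert (M * ((a - b) / (2 * N)) <= N * ((a - b) / (2 * N))).
{ apply Rmult_le_compat_r; [lra|]. pose proof (Rle_abs M). unfold N; lra. }
replace (N * ((a - b) / (2 * N))) with ((a - b) / 2) in * by (field; lra).
lra.
Qed.

Lemma borel_estimate (mu nu : set -> R) (C0 K eps y : R) :
  is_prob_on_01 mu -> is_prob_on_01 nu -> 1 <= C0 ->
  dyadic_doubling C0 mu -> dyadic_doubling C0 nu ->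
  0 < eps <= 1 -> 4 * C0 * bellman_max K * eps <= 1 ->
  C0 ^ 2 * (2 * K + 1) * eps <= 1 ->
  (forall n k j, (j < 2 ^ k)%nat ->
     tree_sum (ratio_weight mu nu) n k j <= K * mu (dyadic k j)) ->
  0 < y ->
  forall k j E, (j < 2 ^ k)%nat -> borel E -> (forall x, E x -> dyadic k j x) ->
  mu E / mu (dyadic k j)
  <= nu E / nu (dyadic k j) / y + Rpower y eps * bellman_max K.
Proof.
intros Hmu Hnu HC HDmu HDnu Heps Hs1 Hs2 HK Hy k j E Hj HE HEJ.
assert (Pm := doubling_pos C0 mu Hmu HC HDmu k j Hj).
assert (Pn := doubling_pos C0 nu Hnu HC HDnu k j Hj).
assert (Mmu := proj1 Hmu). assert (Mnu := proj1 Hnu).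
set (m := mu (dyadic k j)) in *. set (v := nu (dyadic k j)) in *.
(* The density threshold is measured against the mean density [m / v], so that the quotient in
   [level_set_estimate] is exactly [y]. *)
set (c := m / v / y).
assert (Hc : 0 < c) by (unfold c; repeat apply Rdiv_lt_0_compat; assumption).
assert (HP : 0 < Rpower y eps) by (unfold Rpower; apply exp_pos).
assert (Hmain : mu E <= c * nu E + m * Rpower y eps * bellman_max K).
(* The same [F] must serve both measures: its error counts once in [mu] and [c] times in [nu]. *)
{ apply Rle_of_le_plus_eps with (c + 1). intros eta Heta.
  destruct (borel_dyadic_approximable (fun A => mu A + nu A) E (measure_plus mu nu Mmu Mnu))
    with (eta := eta) as [l [F [HF [HFl HFE]]]]; [|exact HE|exact Heta|].
  { destruct Hmu as [_ [_ ->]]. destruct Hnu as [_ [_ ->]]. ring. }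
  assert (Hsd := borel_symdiff E F HE HF).
  assert (Gm := measure_ge0 mu _ Mmu Hsd). assert (Gn := measure_ge0 nu _ Mnu Hsd).
  assert (HFJ : borel (fun x => F x /\ dyadic k j x)) by auto using borel_and, borel_dyadic.
  assert (H1 : mu E <= mu (fun x => F x /\ dyadic k j x) + mu (symdiff E F)).
  { apply measure_subadd; auto. intros x Hx. specialize (HEJ x Hx). unfold symdiff. tauto. }
  assert (H2 : nu (fun x => F x /\ dyadic k j x) <= nu E + nu (symdiff E F)).
  { apply measure_subadd; auto. intros x [Hx _]. unfold symdiff. tauto. }
  assert (H3 := level_set_estimate mu nu C0 K eps c Hmu Hnu HC HDmu HDnu Heps Hs1 Hs2 HK Hc
                  l k j F Hj HF (level_set_mono l (k + l) F ltac:(lia) HFl)).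
  fold m v in H3.
  replace (m / (c * v)) with y in H3 by (unfold c; field; lra).
  assert (Hb : bellman K (tree_sum (ratio_weight mu nu) l k j / m) <= bellman_max K).
  { apply bellman_bounds. split.
    - apply Rmult_le_pos; [|now apply Rlt_le, Rinv_0_lt_compat].
      apply tree_sum_ge0. intros k' j'. apply Rmult_le_pos; [apply pow2_ge_0|].
      apply measure_ge0; auto using borel_dyadic.
    - apply Rmult_le_reg_r with m; [exact Pm|].
      unfold Rdiv. rewrite Rmult_assoc, Rinv_l, Rmult_1_r by lra. now apply HK. }
  apply Rmult_le_compat_l with (r := m * Rpower y eps) in Hb;
    [|apply Rmult_le_pos; lra].
  assert (H4 : c * nu (fun x => F x /\ dyadic k j x) <= c * (nu E + eta))
    by (apply Rmult_le_compat_l; lra).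
  lra. }
apply Rmult_le_reg_r with m; [exact Pm|].
replace (mu E / m * m) with (mu E) by (field; lra).
replace ((nu E / v / y + Rpower y eps * bellman_max K) * m)
  with (c * nu E + m * Rpower y eps * bellman_max K) by (unfold c; field; lra).
exact Hmain.
Qed.

Theorem mainTheorem4 (mu nu : set -> R) (C0 C : R) :
  is_prob_on_01 mu -> is_prob_on_01 nu ->
  1 <= C0 -> dyadic_doubling C0 mu -> dyadic_doubling C0 nu ->
  1 <= C ->
  (forall k j, (j < 2 ^ k)%nat ->
     forall N, carleson_partial mu nu k j N <= C * mu (dyadic k j)) ->
  A_inf_dyadic nu mu.
Proof.
intros Hmu Hnu HC HDmu HDnu HC1 Hcarl.
set (K := 128 * C0 ^ 4 * (1 + C0) * C).
assert (HK0 : 0 <= K).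
{ assert (0 <= C0 ^ 4) by (apply pow_le; lra). unfold K.
  repeat apply Rmult_le_pos; lra. }
assert (HK : forall n k j, (j < 2 ^ k)%nat ->
  tree_sum (ratio_weight mu nu) n k j <= K * mu (dyadic k j)).
{ intros n k j Hj. now apply ratio_weight_carleson. }
set (Phi := bellman_max K).
assert (HPhi : 1 <= Phi) by (unfold Phi, bellman_max; nra).
(* The sum of the two constants that [eps] has to beat, so [eps = 1 / A] meets both smallness
   conditions. *)
set (A := 4 * C0 * Phi + C0 ^ 2 * (2 * K + 1)).
assert (HA1 : 1 <= 4 * C0 * Phi) by nra.
assert (HA2 : 1 <= C0 ^ 2 * (2 * K + 1)).
{ assert (1 <= C0 ^ 2) by (apply pow_R1_Rle; exact HC). nra. }
set (eps := / A).
assert (HA : 2 <= A) by (unfold A; lra).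
assert (Heps0 : 0 < eps) by (apply Rinv_0_lt_compat; lra).
assert (HepsA : A * eps = 1) by (apply Rinv_r; lra).
assert (Heps : 0 < eps <= 1) by nra.
assert (Hs1 : 4 * C0 * Phi * eps <= 1).
{ apply Rle_trans with (A * eps); [|lra].
  apply Rmult_le_compat_r; [lra | unfold A; lra]. }
assert (Hs2 : C0 ^ 2 * (2 * K + 1) * eps <= 1).
{ apply Rle_trans with (A * eps); [|lra].
  apply Rmult_le_compat_r; [lra | unfold A; lra]. }
(* With [y] the square root of [x], the estimate reads [y + Phi y^eps]. As [y] and [eps] are at most
   1, this is at most [(1 + Phi) y^eps], and [y^eps = x^(eps / 2)]. *)
exists (1 + Phi), (eps / 2). split; [lra|]. split; [lra|].
intros k j E Hj HE HEJ.
assert (Pm := doubling_pos C0 mu Hmu HC HDmu k j Hj).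
assert (Pn := doubling_pos C0 nu Hnu HC HDnu k j Hj).
assert (Hest := fun y Hy => borel_estimate mu nu C0 K eps y Hmu Hnu HC HDmu HDnu Heps
                  Hs1 Hs2 HK Hy k j E Hj HE HEJ).
fold Phi in Hest.
set (x := nu E / nu (dyadic k j)) in *. set (z := mu E / mu (dyadic k j)) in *.
assert (Hx1 : x <= 1).
{ assert (H := measure_mono nu E (dyadic k j) (proj1 Hnu) HE (borel_dyadic k j) HEJ).
  apply Rmult_le_reg_r with (nu (dyadic k j)); [exact Pn|].
  unfold x, Rdiv. rewrite Rmult_assoc, Rinv_l; lra. }
unfold rpow. destruct Rle_dec as [Hx|Hx].
(* Here [rpow] is 0 by convention, so the claim is that [mu E] vanishes; the first term of the
   estimate is 0 for every [y], and a small [y] contradicts [z > 0]. *)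
- assert (Hx0 : x = 0).
  { apply Rle_antisym; [exact Hx|]. apply Rmult_le_pos.
    - apply measure_ge0; [apply Hnu | exact HE].
    - now apply Rlt_le, Rinv_0_lt_compat. }
  rewrite Rmult_0_r. apply Rnot_lt_le. intros Hz.
  (* [y] is chosen so that [Rpower y eps * Phi = z / 2] *)
  set (y := Rpower (z / (2 * Phi)) (/ eps)).
  assert (Hy : 0 < y) by (unfold y, Rpower; apply exp_pos).
  specialize (Hest y Hy).
  assert (Hye : Rpower y eps = z / (2 * Phi)).
  { unfold y. rewrite Rpower_mult, Rinv_l by lra. apply Rpower_1.
    apply Rdiv_lt_0_compat; lra. }
  rewrite Hye, Hx0 in Hest.
  replace (0 / y + z / (2 * Phi) * Phi) with (z / 2) in Hest by (field; lra).
  lra.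
- apply Rnot_le_lt in Hx.
  set (y := Rpower x (/ 2)).
  assert (Hy : 0 < y) by (unfold y, Rpower; apply exp_pos).
  assert (Hyy : y * y = x).
  { unfold y. rewrite <- Rpower_plus.
    replace (/ 2 + / 2) with 1 by field. now apply Rpower_1. }
  assert (Hye : Rpower y eps = Rpower x (eps / 2)).
  { unfold y. rewrite Rpower_mult. f_equal. field. }
  assert (Hyle : y <= Rpower y eps).
  { assert (y <= 1) by nra.
    assert (Hln := ln_le_sub1 y Hy).
    rewrite <- (exp_ln y Hy) at 1. unfold Rpower.
    assert (Hcmp : ln y <= eps * ln y) by nra.
    destruct (Rle_lt_or_eq_dec _ _ Hcmp) as [H'|H'];
      [left; now apply exp_increasing | right; now rewrite <- H']. }
  specialize (Hest y Hy). rewrite <- Hye.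
  replace (x / y) with y in Hest by (rewrite <- Hyy; field; lra).
  lra.
Qed.
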